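(* Let $\mathcal{T}_\circ$ be the family of Poncelet triangles inscribed in the non-circular ellipse $\mathcal{E}$ with semiaxes $a>b$ and circumscribing a circle $\mathcal{K}$ with center $C=[x_c,y_c]$. For each triangle let $\Gamma$ denote the radical axis of its incircle and its circumcircle. Over $\mathcal{T}_\circ$, the envelope of $\Gamma$ is a conic whose major axis coincides with that of the locus $\mathcal{L}_3$ of the circumcenter, i.e., it is along the line $F_3F_3'$. The envelope is an ellipse if $C$ is interior to $\mathcal{E}_\triangle$, and a hyperbola if $C$ is exterior to $\mathcal{E}_\triangle$.
   Context: $\mathcal{E}$ is the ellipse $x^2/a^2+y^2/b^2=1$ with $a>b>0$, and $c^2=a^2-b^2$. $\mathcal{K}$ is a circle with center $C=[x_c,y_c]$ contained in the interior of $\mathcal{E}$, whose radius is such that some triangle is inscribed in $\mathcal{E}$ and has its three sides tangent to $\mathcal{K}$; by Poncelet's porism every point of $\mathcal{E}$ is then a vertex of such a triangle, and $\mathcal{T}_\circ$ is the one-parameter family of all such triangles ($\mathcal{K}$ is their common incircle). $\mathcal{L}_3$, the locus of the circumcenters $X_3$ over $\mathcal{T}_\circ$, is known to be a conic with foci $F_3=[x_c(1-(b/a)^2),0]$ and $F_3'=[0,y_c(1-(a/b)^2)]$. The radical axis of two circles is the line of points having equal power with respect to both. $\mathcal{E}_\triangle$ is the locus of centroids of equilateral triangles inscribed in $\mathcal{E}$; it is the ellipse concentric and axis-aligned with $\mathcal{E}$, with semiaxes $a_\triangle=\frac{a\,c^2}{a^2+3b^2}$ (along $x$) and $b_\triangle=\frac{b\,c^2}{3a^2+b^2}$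 (along $y$). ''Coincides'' for major axes refers to the lines containing them (the line through the foci; when the conic is a circle any line through its center qualifies). The envelope of lines $l(u)x+m(u)y+n(u)=0$ is the curve of points satisfying this equation and its $u$-derivative. *)

(* Defs.v *)
From Stdlib Require Import Reals List Permutation.
From Coquelicot Require Import Coquelicot.
Import ListNotations.
Open Scope R_scope.

(** * Plane geometry *)

Definition point : Type := (R * R)%type.

Definition dist (P Q : point) : R := dist_euc (fst P) (snd P) (fst Q) (snd Q).

Definition is_line (L : point -> Prop) : Prop :=
  exists p q c : R, (p, q) <> (0, 0) /\
    forall P : point, L P <-> p * fst P + q * snd P + c = 0.

Definition collinear (A B C : point) : Prop :=
  (fst B - fst A) * (snd C - snd A) - (snd B - snd A) * (fst C - fst A) = 0.

Record circle : Type := Circle { center : point; radius : R }.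

Definition on_circle (K : circle) (P : point) : Prop := dist P (center K) = radius K.

Definition power (K : circle) (P : point) : R := dist P (center K) ^ 2 - radius K ^ 2.

(** The contact point [T] lies on the closed segment [PQ], not merely on the
    line [PQ]: a circle of positive radius tangent in this sense to the three
    sides of a nondegenerate triangle is its incircle, never an excircle. *)
Definition side_tangent (K : circle) (P Q : point) : Prop :=
  exists T : point,
    (exists s : R, 0 <= s <= 1 /\
       T = (fst P + s * (fst Q - fst P), snd P + s * (snd Q - snd P))) /\
    on_circle K T /\
    (fst T - fst (center K)) * (fst Q - fst P) +
    (snd T - snd (center K)) * (snd Q - snd P) = 0.

Definition is_incircle (K : circle) (A B C : point) : Prop :=
  side_tangent K A B /\ side_tangent K B C /\ side_tangent K C A.

Definition is_circumcircle (S : circle) (A B C : point) : Prop :=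
  on_circle S A /\ on_circle S B /\ on_circle S C.

Definition radical_axis (K S : circle) (P : point) : Prop := power K P = power S P.

(** * Conics and their major axes *)

Definition ellipse_with_foci (S : point -> Prop) (F F' : point) : Prop :=
  exists s : R, dist F F' < 2 * s /\
    forall P : point, S P <-> dist P F + dist P F' = 2 * s.

Definition hyperbola_with_foci (S : point -> Prop) (F F' : point) : Prop :=
  exists s : R, 0 < s /\ 2 * s < dist F F' /\
    forall P : point, S P <-> Rabs (dist P F - dist P F') = 2 * s.

(** [G] is the foot of the perpendicular from the focus [F] to the directrix,
    so the right-hand side is the distance from [P] to the directrix. *)
Definition parabola_with_focus_foot (S : point -> Prop) (F G : point) : Prop :=
  F <> G /\
  forall P : point, S P <->
    dist P F = Rabs ((fst P - fst G) * (fst F - fst G) +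
                     (snd P - snd G) * (snd F - snd G)) / dist F G.

Definition is_ellipse (S : point -> Prop) : Prop :=
  exists F F' : point, ellipse_with_foci S F F'.

Definition is_hyperbola (S : point -> Prop) : Prop :=
  exists F F' : point, hyperbola_with_foci S F F'.

(** [S] is a nondegenerate conic and [L] contains its major (focal) axis.  For
    a circle the two foci agree, and every line through the center qualifies;
    for a parabola [L] is the axis of symmetry. *)
Definition conic_with_major_axis (S L : point -> Prop) : Prop :=
  is_line L /\
  exists F F' : point, L F /\ L F' /\
    (ellipse_with_foci S F F' \/ hyperbola_with_foci S F F' \/
     parabola_with_focus_foot S F F').

(** * Axis-aligned ellipses centered at the origin *)

Definition ellipse_form (a b : R) (P : point) : R :=
  fst P ^ 2 / a ^ 2 + snd P ^ 2 / b ^ 2.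

Definition on_ellipse (a b : R) (P : point) : Prop := ellipse_form a b P = 1.
Definition in_ellipse (a b : R) (P : point) : Prop := ellipse_form a b P < 1.
Definition out_ellipse (a b : R) (P : point) : Prop := 1 < ellipse_form a b P.

(** Semiaxes of the locus of centroids of the equilateral triangles inscribed
    in the ellipse with semiaxes [a] and [b]. *)
Definition a_tri (a b : R) : R := a * (a ^ 2 - b ^ 2) / (a ^ 2 + 3 * b ^ 2).
Definition b_tri (a b : R) : R := b * (a ^ 2 - b ^ 2) / (3 * a ^ 2 + b ^ 2).

(** * The Poncelet family *)

Definition poncelet_triangle (a b : R) (K : circle) (A B C : point) : Prop :=
  ~ collinear A B C /\
  on_ellipse a b A /\ on_ellipse a b B /\ on_ellipse a b C /\
  is_incircle K A B C.

Definition circumcenter_locus (a b : R) (K : circle) (X : point) : Prop :=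
  exists (A B C : point) (S : circle),
    poncelet_triangle a b K A B C /\ is_circumcircle S A B C /\ center S = X.

(** The foci of [circumcenter_locus a b K]; they agree when [K] is centered at
    the origin, where the locus is a circle. *)
Definition focus3 (a b : R) (K : circle) : point :=
  (fst (center K) * (1 - (b / a) ^ 2), 0).
Definition focus3' (a b : R) (K : circle) : point :=
  (0, snd (center K) * (1 - (a / b) ^ 2)).

Definition ex_derive_point (f : R -> point) (u : R) : Prop :=
  ex_derive (fun v => fst (f v)) u /\ ex_derive (fun v => snd (f v)) u.

Definition velocity (f : R -> point) (u : R) : point :=
  (Derive (fun v => fst (f v)) u, Derive (fun v => snd (f v)) u).

(** A differentiable parametrization of the whole family, up to relabelling of
    the vertices.  Without the nonvanishing velocity, a parameter at which the
    triangle is momentarily stationary would put its entire radical axis into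
    the envelope. *)
Definition poncelet_parametrization (a b : R) (K : circle) (A B C : R -> point) : Prop :=
  (forall u : R, poncelet_triangle a b K (A u) (B u) (C u)) /\
  (forall P Q T : point, poncelet_triangle a b K P Q T ->
     exists u : R, Permutation [P; Q; T] [A u; B u; C u]) /\
  (forall u : R, ex_derive_point A u /\ ex_derive_point B u /\ ex_derive_point C u) /\
  (forall u : R, velocity A u <> (0, 0) \/ velocity B u <> (0, 0) \/
                 velocity C u <> (0, 0)).

(** [l(u) x + m(u) y + n(u) = 0] is the radical axis of the incircle [K] and of
    the circumcircle of the triangle with parameter [u].  If that triangle is
    equilateral then its two circles are concentric and the radical axis is
    empty: [l(u) = m(u) = 0] and [n(u) <> 0]. *)
Definition radical_axis_family (a b : R) (K : circle) (A B C : R -> point)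
    (l m n : R -> R) : Prop :=
  poncelet_parametrization a b K A B C /\
  (forall u : R, ex_derive l u /\ ex_derive m u /\ ex_derive n u) /\
  (forall (u : R) (P : point),
     l u * fst P + m u * snd P + n u = 0 <->
     exists S : circle, is_circumcircle S (A u) (B u) (C u) /\ radical_axis K S P).

Definition envelope (l m n : R -> R) (P : point) : Prop :=
  exists u : R,
    l u * fst P + m u * snd P + n u = 0 /\
    Derive l u * fst P + Derive m u * snd P + Derive n u = 0.

(* Main.v *)
From Stdlib Require Import Reals Lra List Permutation.
From Coquelicot Require Import Coquelicot.
Require Import Defs.
Import ListNotations.
Open Scope R_scope.

(** Choose the center of the incircle as origin and its radius as unit, and read
    points as complex numbers.  A circumscribed triangle is given by its contact
    points [z1], [z2], [z3] on the unit circle, its vertices being the poles of the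
    chords.  That the pole of [z1 z2] lies on the conic
    [A x ^ 2 + B y ^ 2 + u1 x + u2 y = 1] is a symmetric condition, affine in each
    contact point.  Imposed on all three pairs it forces
    [z1 + z2 + z3 = u + v z1 z2 z3] with [v = B - A] ([triangle_sum]) and
    Cayley's relation [|u| ^ 2 = 1 + v ^ 2 - 2 (A + B)] ([cayley]).  Conversely,
    under Cayley's relation every unit solution of that equation is a Poncelet
    triangle ([triangle_of_sum]), which is Poncelet's porism.  Hence the contact
    sum [s = z1 + z2 + z3] runs on the circle with center [u] and radius [v]; it
    reaches all of this circle ([triangle_with_sum]) and its velocity vanishes
    only where the whole triangle rests ([contact_sum_regular]).

    Inversion in the incircle turns the circumcircle into the nine-point circle of
    the contact triangle, with center [s / 2] and radius [1 / 2] ([apex_circle]).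
    So the radical axis is [4 w s = 3 + |s| ^ 2], the product being the scalar
    one.  On the circle of contact sums [|s| ^ 2] is affine in [s], and the
    equation becomes [(w - u / 2) s = k] with a constant [k]
    ([radical_axis_polar]): the radical axes are the polars of the points of a
    circle.  Their envelope is the polar reciprocal of that circle, a conic with
    focus [u / 2], axis along [u] and eccentricity [|u| / v]
    ([envelope_polar_circle], [envelope_equation]).  When the contact sum is 0 the
    triangle is equilateral and its radical axis empty; this happens exactly when
    the conic is a parabola.

    The circumcenter is a projective image of [s], which yields the ellipse with
    the foci [focus3] and [focus3'] ([circumcenter_locus_ellipse]).  All the foci
    are obtained from the center of the incircle by multiples of the gradient of
    the ellipse there, so the axes agree ([envelope_axis]).  Finally the sign of
    [|u| - v] is decided by Cayley's relation, a quadratic equation for the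
    squared inradius whose smaller root is the relevant one because [v < 1]
    ([eccentricity_sign]). *)

(** * Plane vectors as complex numbers *)

Definition dot (P Q : point) : R := fst P * fst Q + snd P * snd Q.
Definition cross (P Q : point) : R := fst P * snd Q - snd P * fst Q.
Definition add (P Q : point) : point := (fst P + fst Q, snd P + snd Q).
Definition sub (P Q : point) : point := (fst P - fst Q, snd P - snd Q).
Definition scale (k : R) (P : point) : point := (k * fst P, k * snd P).
Definition cmul (P Q : point) : point :=
  (fst P * fst Q - snd P * snd Q, fst P * snd Q + snd P * fst Q).
Definition conjugate (P : point) : point := (fst P, - snd P).
Definition sum3 (P Q T : point) : point := add (add P Q) T.
Definition cmul3 (P Q T : point) : point := cmul (cmul P Q) T.

Ltac coords :=
  unfold sum3, cmul3, add, sub, scale, cmul, conjugate, dot, cross in *; cbn [fst snd] in *.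

Lemma dot_zero_basis (e P Q : point) :
  dot P e = 0 -> dot Q e = 0 -> cross P Q <> 0 -> e = (0, 0).
Proof.
  destruct e as [e1 e2], P as [p1 p2], Q as [q1 q2]. coords. intros H1 H2 Hc.
  f_equal; apply (Rmult_eq_reg_l (p1 * q2 - p2 * q1)); trivial; clear Hc.
  - transitivity (q2 * (p1 * e1 + p2 * e2) - p2 * (q1 * e1 + q2 * e2)); [ring|].
    rewrite H1, H2. ring.
  - transitivity (p1 * (q1 * e1 + q2 * e2) - q1 * (p1 * e1 + p2 * e2)); [ring|].
    rewrite H1, H2. ring.
Qed.

Lemma point_neq_sqdist (P Q : point) : P <> Q -> 0 < dot (sub P Q) (sub P Q).
Proof.
  destruct P as [p1 p2], Q as [q1 q2]. coords. intros H.
  assert (D : p1 - q1 <> 0 \/ p2 - q2 <> 0).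
  { destruct (Req_dec p1 q1) as [E|E]; [right|left; lra].
    intros E'. apply H. f_equal; lra. }
  pose proof (Rle_0_sqr (p1 - q1)). pose proof (Rle_0_sqr (p2 - q2)).
  destruct D as [D|D]; apply Rsqr_pos_lt in D; unfold Rsqr in *; lra.
Qed.

Lemma dot_self_eq0 (P : point) : dot P P = 0 -> P = (0, 0).
Proof.
  destruct P as [p1 p2]. coords. intros E. apply Rplus_sqr_eq_0 in E as [-> ->]. reflexivity.
Qed.

(** A line meets a circle in at most two points.  Quantitatively, four times the
    squared area determinant of a triangle of circumradius 1 is the product of
    its squared side lengths, by the vanishing Gram determinant of three plane
    vectors. *)
Lemma unit_points_noncollinear (z1 z2 z3 : point) :
  dot z1 z1 = 1 -> dot z2 z2 = 1 -> dot z3 z3 = 1 ->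
  z1 <> z2 -> z2 <> z3 -> z3 <> z1 -> cross (sub z2 z3) (sub z1 z3) <> 0.
Proof.
  intros H1 H2 H3 N12%point_neq_sqdist N23%point_neq_sqdist N31%point_neq_sqdist Hc.
  assert (E : 4 * (cross (sub z2 z3) (sub z1 z3)) ^ 2 =
     dot (sub z1 z2) (sub z1 z2) * dot (sub z2 z3) (sub z2 z3) * dot (sub z3 z1) (sub z3 z1)).
  { assert (G : dot z1 z1 * dot z2 z2 * dot z3 z3 + 2 * (dot z1 z2 * dot z2 z3 * dot z3 z1)
      = dot z1 z1 * dot z2 z3 ^ 2 + dot z2 z2 * dot z3 z1 ^ 2 + dot z3 z3 * dot z1 z2 ^ 2)
      by (coords; ring).
    assert (S : forall P Q, dot (sub P Q) (sub P Q) = dot P P + dot Q Q - 2 * dot P Q)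
      by (intros; coords; ring).
    assert (X : cross (sub z2 z3) (sub z1 z3) ^ 2 = dot (sub z2 z3) (sub z2 z3) *
      dot (sub z3 z1) (sub z3 z1) - (dot z1 z2 - dot z2 z3 - dot z3 z1 + dot z3 z3) ^ 2)
      by (coords; ring).
    rewrite X, !S. rewrite ?H1, ?H2, ?H3 in *. lra. }
  rewrite Hc in E. apply Rlt_not_eq in N12, N23, N31.
  assert (E0 : 0 = dot (sub z1 z2) (sub z1 z2) * dot (sub z2 z3) (sub z2 z3) * dot (sub z3 z1) (sub z3 z1)) by (rewrite <- E; ring).
  symmetry in E0. apply Rmult_integral in E0 as [E0|]; [apply Rmult_integral in E0 as [|]|]; lra.
Qed.

(** Tangents at antipodal points are parallel and have no common point. *)
Lemma tangents_not_antipodal (z1 z2 W : point) :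
  dot z1 z1 = 1 -> dot z2 z2 = 1 -> dot z1 W = 1 -> dot z2 W = 1 -> 1 + dot z1 z2 <> 0.
Proof.
  intros H1 H2 W1 W2 D.
  assert (E : dot (add z1 z2) (add z1 z2) = 0).
  { transitivity (dot z1 z1 + dot z2 z2 + 2 * dot z1 z2); [coords; ring|]. lra. }
  apply dot_self_eq0 in E.
  assert (E2 : dot (add z1 z2) W = 2) by (clear - W1 W2; coords; lra).
  rewrite E in E2. clear - E2. coords. lra.
Qed.

Lemma tangents_independent (z1 z2 W : point) :
  dot z1 z1 = 1 -> dot z2 z2 = 1 -> z1 <> z2 -> dot z1 W = 1 -> dot z2 W = 1 ->
  cross z1 z2 <> 0.
Proof.
  intros H1 H2 N%point_neq_sqdist W1 W2 C.
  pose proof (tangents_not_antipodal z1 z2 W H1 H2 W1 W2) as D.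
  assert (E : cross z1 z2 ^ 2 = (1 + dot z1 z2) * (dot (sub z1 z2) (sub z1 z2)) / 2).
  { transitivity (dot z1 z1 * dot z2 z2 - dot z1 z2 ^ 2); [coords; ring|].
    replace (dot (sub z1 z2) (sub z1 z2)) with (dot z1 z1 + dot z2 z2 - 2 * dot z1 z2)
      by (coords; ring).
    rewrite H1, H2. field. }
  rewrite C in E. assert (E0 : (1 + dot z1 z2) * (dot (sub z1 z2) (sub z1 z2)) = 0) by lra.
  apply Rmult_integral in E0 as [|]; lra.
Qed.

(** The tangents to the unit circle at [z1] and [z2] meet on the bisector of the
    contact radii; the multiplied form avoids the division by [1 + dot z1 z2]. *)
Lemma apex (z1 z2 W : point) :
  dot z1 z1 = 1 -> dot z2 z2 = 1 -> z1 <> z2 -> dot z1 W = 1 -> dot z2 W = 1 ->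
  1 + dot z1 z2 <> 0 /\ scale (1 + dot z1 z2) W = add z1 z2.
Proof.
  intros H1 H2 N W1 W2. split; [now apply (tangents_not_antipodal z1 z2 W)|].
  assert (E : sub (scale (1 + dot z1 z2) W) (add z1 z2) = (0,0)).
  { apply (dot_zero_basis _ z1 z2); [| |now apply (tangents_independent z1 z2 W)].
    - transitivity ((1 + dot z1 z2) * dot z1 W - dot z1 z1 - dot z1 z2); [coords; ring|].
      rewrite H1, W1. ring.
    - transitivity ((1 + dot z1 z2) * dot z2 W - dot z2 z2 - dot z1 z2); [coords; ring|].
      rewrite H2, W2. ring. }
  clear - E. coords. injection E. intros. f_equal; lra.
Qed.

Lemma dot_self_ge0 (P : point) : 0 <= dot P P.
Proof. unfold dot. nra. Qed.

Lemma unit_angle (P : point) : dot P P = 1 -> exists t, P = (cos t, sin t).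
Proof.
  destruct P as [x y]. unfold dot. cbn [fst snd]. intros E.
  assert (X : -1 <= x <= 1) by nra.
  assert (S : sin (acos x) = sqrt (y * y)).
  { rewrite sin_acos; trivial. f_equal. unfold Rsqr. lra. }
  destruct (Rle_or_lt 0 y) as [Y|Y].
  - exists (acos x). rewrite cos_acos, S, sqrt_square; trivial.
  - exists (- acos x). rewrite cos_neg, sin_neg, cos_acos, S; trivial.
    replace (y * y) with ((- y) * (- y)) by ring. rewrite sqrt_square by lra. f_equal; ring.
Qed.

Lemma dot_unit_lt (s e : point) : dot s s < 1 -> dot e e = 1 -> Rabs (dot s e) < 1.
Proof.
  intros S E. pose proof (dot_self_ge0 (sub s e)) as P1. pose proof (dot_self_ge0 (add s e)) as P2.
  replace (dot (sub s e) (sub s e)) with (dot s s - 2 * dot s e + dot e e) in P1 by (coords; ring).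
  replace (dot (add s e) (add s e)) with (dot s s + 2 * dot s e + dot e e) in P2 by (coords; ring).
  apply Rabs_def1; lra.
Qed.

(** * Velocities of moving points *)

(** [auto_derive] differentiates unknown functions from [R] to [R] only, not the
    coordinates of a point-valued function; these are abstracted first. *)
Ltac scalarize f :=
  let a := fresh "a" in let b := fresh "b" in
  set (a := fun s : R => fst (f s)) in *; set (b := fun s : R => snd (f s)) in *;
  change (fun s : R_AbsRing => fst (f s)) with a in *;
  change (fun s : R_AbsRing => snd (f s)) with b in *;
  change (fst (f ?x)) with (a x); change (snd (f ?x)) with (b x); clearbody a b.

(** [auto_derive] leaves eta-expanded derivatives, which [ring] does not identify
    with the unexpanded ones. *)
Ltac derive_ring :=
  auto_derive; [tauto|];
  repeat match goal with
  | |- context [Derive (fun x => ?h x)] => progress change (fun x : R => h x) with h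
  end; ring.

Lemma velocity_unique (f : R -> point) (t : R) (d : point) :
  is_derive (fun s => fst (f s)) t (fst d) -> is_derive (fun s => snd (f s)) t (snd d) ->
  velocity f t = d.
Proof.
  intros D1 D2. apply injective_projections; [exact (is_derive_unique _ _ _ D1)|exact (is_derive_unique _ _ _ D2)].
Qed.

Lemma velocity_ext (f g : R -> point) (t : R) :
  (forall s, f s = g s) -> velocity f t = velocity g t.
Proof.
  intros E. unfold velocity. f_equal; apply Derive_ext; intros s; now rewrite E.
Qed.

Lemma derive_constant (f : R -> R) (t d c : R) :
  (forall s, f s = c) -> is_derive f t d -> d = 0.
Proof.
  intros E D. apply is_derive_unique in D. rewrite <- D, (Derive_ext _ (fun _ => c)); trivial.
  apply Derive_const.
Qed.

Lemma is_derive_dot (f g : R -> point) (t : R) :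
  ex_derive_point f t -> ex_derive_point g t ->
  is_derive (fun s => dot (f s) (g s)) t (dot (velocity f t) (g t) + dot (f t) (velocity g t)).
Proof.
  intros F G. unfold ex_derive_point in *. unfold velocity. coords. scalarize f. scalarize g. derive_ring.
Qed.

Lemma unit_velocity (z : R -> point) (t : R) :
  (forall s, dot (z s) (z s) = 1) -> ex_derive_point z t -> dot (z t) (velocity z t) = 0.
Proof.
  intros U D. pose proof (is_derive_dot z z t D D) as E. apply (derive_constant _ _ _ 1 U) in E.
  unfold dot in *. lra.
Qed.

Lemma sum3_differentiable (z1 z2 z3 : R -> point) (t : R) :
  ex_derive_point z1 t -> ex_derive_point z2 t -> ex_derive_point z3 t ->
  ex_derive_point (fun s => sum3 (z1 s) (z2 s) (z3 s)) t.
Proof.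
  intros D1 D2 D3. unfold ex_derive_point in *. coords.
  scalarize z1; scalarize z2; scalarize z3. split; auto_derive; tauto.
Qed.

Lemma velocity_sum3 (z1 z2 z3 : R -> point) (t : R) :
  ex_derive_point z1 t -> ex_derive_point z2 t -> ex_derive_point z3 t ->
  velocity (fun s => sum3 (z1 s) (z2 s) (z3 s)) t = sum3 (velocity z1 t) (velocity z2 t) (velocity z3 t).
Proof.
  intros D1 D2 D3. unfold ex_derive_point in *. apply velocity_unique; unfold velocity; coords;
  scalarize z1; scalarize z2; scalarize z3; derive_ring.
Qed.

Lemma velocity_cmul3 (z1 z2 z3 : R -> point) (t : R) :
  ex_derive_point z1 t -> ex_derive_point z2 t -> ex_derive_point z3 t ->
  velocity (fun s => cmul3 (z1 s) (z2 s) (z3 s)) t =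
  sum3 (cmul3 (velocity z1 t) (z2 t) (z3 t)) (cmul3 (z1 t) (velocity z2 t) (z3 t))
       (cmul3 (z1 t) (z2 t) (velocity z3 t)).
Proof.
  intros D1 D2 D3. unfold ex_derive_point in *. apply velocity_unique; unfold velocity; coords;
  scalarize z1; scalarize z2; scalarize z3; derive_ring.
Qed.

(** Points on the unit circle have velocities [w_j i z_j].  If the sum and the
    product of three of them are stationary, then [w1 z1 + w2 z2 + w3 z3 = 0] and
    [w1 + w2 + w3 = 0]; these say that all [w_j] vanish, as the points are not
    collinear. *)
Lemma unit_velocities_zero (z1 z2 z3 d1 d2 d3 : point) :
  dot z1 z1 = 1 -> dot z2 z2 = 1 -> dot z3 z3 = 1 ->
  z1 <> z2 -> z2 <> z3 -> z3 <> z1 ->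
  dot z1 d1 = 0 -> dot z2 d2 = 0 -> dot z3 d3 = 0 ->
  sum3 d1 d2 d3 = (0, 0) ->
  sum3 (cmul3 d1 z2 z3) (cmul3 z1 d2 z3) (cmul3 z1 z2 d3) = (0, 0) ->
  d1 = (0, 0) /\ d2 = (0, 0) /\ d3 = (0, 0).
Proof.
  intros U1 U2 U3 N12 N23 N31 O1 O2 O3 S P.
  pose proof (unit_points_noncollinear z1 z2 z3 U1 U2 U3 N12 N23 N31) as C.
  assert (J : forall z d, dot z z = 1 -> dot z d = 0 -> d = scale (cross z d) (- snd z, fst z)).
  { intros z d U O. transitivity (sub (scale (dot z z) d) (scale (dot z d) z)).
    - rewrite U, O. apply injective_projections; coords; ring.
    - coords. f_equal; ring. }
  apply J in O1, O2, O3; trivial. clear J.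
  set (w1 := cross z1 d1) in *. set (w2 := cross z2 d2) in *. set (w3 := cross z3 d3) in *.
  clearbody w1 w2 w3. subst d1 d2 d3.
  assert (W : w1 + w2 + w3 = 0).
  { assert (X : dot (sum3 (cmul3 (scale w1 (- snd z1, fst z1)) z2 z3)
        (cmul3 z1 (scale w2 (- snd z2, fst z2)) z3) (cmul3 z1 z2 (scale w3 (- snd z3, fst z3))))
        (cmul (0, 1) (cmul3 z1 z2 z3)) = 0).
    { rewrite P. coords. ring. }
    rewrite <- X. transitivity ((w1 + w2 + w3) * (dot z1 z1 * dot z2 z2 * dot z3 z3)).
    - rewrite U1, U2, U3. ring.
    - clear. coords. ring. }
  assert (K : sum3 (scale w1 z1) (scale w2 z2) (scale w3 z3) = (0, 0)).
  { clear - S. coords. injection S. intros. f_equal; lra. }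
  assert (E1 : w1 * cross (sub z2 z3) (sub z1 z3) = 0).
  { transitivity (cross (sub z2 z3) (sub (sum3 (scale w1 z1) (scale w2 z2) (scale w3 z3)) (scale (w1 + w2 + w3) z3))).
    - coords; ring.
    - rewrite K, W. coords; ring. }
  assert (E2 : w2 * cross (sub z2 z3) (sub z1 z3) = 0).
  { transitivity (cross (sub (sum3 (scale w1 z1) (scale w2 z2) (scale w3 z3)) (scale (w1 + w2 + w3) z3)) (sub z1 z3)).
    - coords; ring.
    - rewrite K, W. coords; ring. }
  apply Rmult_integral in E1, E2.
  assert (w1 = 0) by tauto. assert (w2 = 0) by tauto. assert (w3 = 0) by lra. subst.
  coords. repeat split; f_equal; ring.
Qed.

(** Differentiating [dot z1 W = 1] and [dot z2 W = 1] leaves a regular homogeneous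
    linear system for the velocity of [W]. *)
Lemma meet_at_rest (z1 z2 W : R -> point) (t : R) :
  (forall s, dot (z1 s) (z1 s) = 1) -> (forall s, dot (z2 s) (z2 s) = 1) -> z1 t <> z2 t ->
  (forall s, dot (z1 s) (W s) = 1) -> (forall s, dot (z2 s) (W s) = 1) ->
  ex_derive_point z1 t -> ex_derive_point z2 t -> ex_derive_point W t ->
  velocity z1 t = (0, 0) -> velocity z2 t = (0, 0) -> velocity W t = (0, 0).
Proof.
  intros U1 U2 N I1 I2 D1 D2 D V1 V2.
  pose proof (is_derive_dot z1 W t D1 D) as E1. apply (derive_constant _ _ _ 1 I1) in E1.
  pose proof (is_derive_dot z2 W t D2 D) as E2. apply (derive_constant _ _ _ 1 I2) in E2.
  rewrite V1 in E1. rewrite V2 in E2.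
  apply (dot_zero_basis _ (z1 t) (z2 t)).
  - unfold dot in *. cbn [fst snd] in E1. lra.
  - unfold dot in *. cbn [fst snd] in E2. lra.
  - apply (tangents_independent _ _ (W t)); trivial.
Qed.

(** * Triangles about the unit circle inscribed in a conic *)

Ltac open_triangle T :=
  destruct T as [unit_1 unit_2 unit_3 neq_12 neq_23 neq_31
                 inc_12 inc_13 inc_21 inc_23 inc_31 inc_32 on_1 on_2 on_3].

(** With [s = z1 + z2] and [p = z1 z2] one has [s ^ 2 = |s| ^ 2 p] and
    [|s| ^ 2 = 2 (1 + dot z1 z2)]; these are the real consequences. *)
Lemma unit_sum_squares (z1 z2 : point) :
  dot z1 z1 = 1 -> dot z2 z2 = 1 ->
  fst (add z1 z2) ^ 2 = (1 + dot z1 z2) * (1 + fst (cmul z1 z2)) /\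
  snd (add z1 z2) ^ 2 = (1 + dot z1 z2) * (1 - fst (cmul z1 z2)).
Proof.
  destruct z1 as [c1 s1], z2 as [c2 s2]. coords. intros H1 H2. split.
  - transitivity ((1 + c1 * c2) ^ 2 - (s1 * s1) * (s2 * s2)); [|ring].
    replace (s1 * s1) with (1 - c1 * c1) by lra. replace (s2 * s2) with (1 - c2 * c2) by lra. ring.
  - transitivity ((1 + s1 * s2) ^ 2 - (c1 * c1) * (c2 * c2)); [|ring].
    replace (c1 * c1) with (1 - s1 * s1) by lra. replace (c2 * c2) with (1 - s2 * s2) by lra. ring.
Qed.

Section Normalized.
Context (A B : R) (u : point).
Let v := B - A.

(** The ellipse in the coordinates where the incircle is the unit circle; the
    constant term, nonzero since the origin is interior, is scaled to [-1]. *)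
Definition conic (W : point) : R := A * fst W ^ 2 + B * snd W ^ 2 + dot u W - 1.

(** Up to a constant and a factor, the conic evaluated at the pole of the chord
    [z1 z2] ([conic_apex]).  It is affine in each of [z1] and [z2], which makes the
    closing condition a linear problem. *)
Definition apex_form (z1 z2 : point) : R :=
  v * fst (cmul z1 z2) + dot z1 z2 - dot u (add z1 z2).

(** The side opposite to the vertex [Wj] touches the unit circle at [zj]. *)
Record tangent_triangle (z1 z2 z3 W1 W2 W3 : point) : Prop := {
  unit1 : dot z1 z1 = 1; unit2 : dot z2 z2 = 1; unit3 : dot z3 z3 = 1;
  neq12 : z1 <> z2; neq23 : z2 <> z3; neq31 : z3 <> z1;
  inc12 : dot z1 W2 = 1; inc13 : dot z1 W3 = 1;
  inc21 : dot z2 W1 = 1; inc23 : dot z2 W3 = 1;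
  inc31 : dot z3 W1 = 1; inc32 : dot z3 W2 = 1;
  on1 : conic W1 = 0; on2 : conic W2 = 0; on3 : conic W3 = 0 }.

Lemma conic_apex (z1 z2 W : point) :
  dot z1 z1 = 1 -> dot z2 z2 = 1 -> 1 + dot z1 z2 <> 0 -> scale (1 + dot z1 z2) W = add z1 z2 ->
  (1 + dot z1 z2) * conic W = A + B - 1 - apex_form z1 z2.
Proof.
  intros H1 H2 D E. apply (Rmult_eq_reg_l (1 + dot z1 z2)); trivial.
  destruct (unit_sum_squares z1 z2 H1 H2) as [S1 S2].
  transitivity (A * fst (scale (1 + dot z1 z2) W) ^ 2 + B * snd (scale (1 + dot z1 z2) W) ^ 2
     + (1 + dot z1 z2) * dot u (scale (1 + dot z1 z2) W) - (1 + dot z1 z2) ^ 2).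
  - unfold conic. generalize (1 + dot z1 z2). intros. coords. ring.
  - rewrite E, S1, S2. unfold apex_form, v. ring.
Qed.

Lemma conic_apex_iff (z1 z2 W : point) :
  dot z1 z1 = 1 -> dot z2 z2 = 1 -> z1 <> z2 -> dot z1 W = 1 -> dot z2 W = 1 ->
  (conic W = 0 <-> apex_form z1 z2 = A + B - 1).
Proof.
  intros H1 H2 N W1 W2. destruct (apex z1 z2 W) as [D E]; trivial.
  pose proof (conic_apex z1 z2 W H1 H2 D E) as F. split; intros G.
  - rewrite G in F. lra.
  - rewrite G in F. assert (F' : (1 + dot z1 z2) * conic W = 0) by lra.
    apply Rmult_integral in F' as [|]; tauto.
Qed.

(** The three vertex conditions say that [apex_form] takes the same value on all
    three pairs.  Their differences are linear equations in [u] whose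
    coefficients are the independent vectors [z2 - z3] and [z1 - z3], and
    [z1 + z2 + z3 - v z1 z2 z3] solves them. *)
Lemma triangle_sum z1 z2 z3 W1 W2 W3 :
  tangent_triangle z1 z2 z3 W1 W2 W3 -> sum3 z1 z2 z3 = add u (scale v (cmul3 z1 z2 z3)).
Proof.
  intros Ht. open_triangle Ht. apply (conic_apex_iff z2 z3) in on_1; trivial.
  apply (conic_apex_iff z3 z1) in on_2; trivial. apply (conic_apex_iff z1 z2) in on_3; trivial.
  assert (E : sub (sum3 z1 z2 z3) (add u (scale v (cmul3 z1 z2 z3))) = (0, 0)).
  { apply (dot_zero_basis _ (sub z2 z3) (sub z1 z3)).
    - transitivity (apex_form z1 z2 - apex_form z3 z1 + (dot z2 z2 - dot z3 z3)
        - v * ((dot z2 z2 - 1) * fst (cmul z1 z3) - (dot z3 z3 - 1) * fst (cmul z1 z2))).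
      + unfold apex_form. coords. ring.
      + rewrite on_2, on_3, unit_2, unit_3. ring.
    - transitivity (apex_form z1 z2 - apex_form z2 z3 + (dot z1 z1 - dot z3 z3)
        - v * ((dot z1 z1 - 1) * fst (cmul z2 z3) - (dot z3 z3 - 1) * fst (cmul z1 z2))).
      + unfold apex_form. coords. ring.
      + rewrite on_1, on_3, unit_1, unit_3. ring.
    - now apply unit_points_noncollinear. }
  clear - E. coords. injection E. intros. f_equal; lra.
Qed.

(** The relation gives [u - (z1 + z2) = z3 (1 - v z1 z2)], so that the third point
    disappears on taking absolute values. *)
Lemma apex_form_of_sum z1 z2 z3 :
  dot z1 z1 = 1 -> dot z2 z2 = 1 -> dot z3 z3 = 1 ->
  sum3 z1 z2 z3 = add u (scale v (cmul3 z1 z2 z3)) ->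
  2 * apex_form z1 z2 = v ^ 2 - 1 - dot u u.
Proof.
  intros H1 H2 H3 E. unfold apex_form.
  assert (E1 : dot (sub u (add z1 z2)) (sub u (add z1 z2)) =
               dot (sub z3 (scale v (cmul3 z1 z2 z3))) (sub z3 (scale v (cmul3 z1 z2 z3)))).
  { replace (sub u (add z1 z2)) with (sub z3 (scale v (cmul3 z1 z2 z3))); trivial.
    clear - E. clearbody v. coords. injection E. intros. f_equal; lra. }
  assert (E2 : dot (sub u (add z1 z2)) (sub u (add z1 z2)) =
    dot u u - 2 * dot u (add z1 z2) + dot z1 z1 + dot z2 z2 + 2 * dot z1 z2)
    by (coords; ring).
  assert (E3 : dot (sub z3 (scale v (cmul3 z1 z2 z3))) (sub z3 (scale v (cmul3 z1 z2 z3))) =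
    dot z3 z3 * (1 - 2 * v * fst (cmul z1 z2) + v ^ 2 * (dot z1 z1 * dot z2 z2)))
    by (coords; ring).
  rewrite E2, E3, H1, H2, H3 in E1. lra.
Qed.

(** Cayley's closing condition for triangles.  [triangle_sum] uses only the differences
    of the three vertex conditions; this is what their common value adds. *)
Lemma cayley z1 z2 z3 W1 W2 W3 :
  tangent_triangle z1 z2 z3 W1 W2 W3 -> dot u u = 1 + v ^ 2 - 2 * (A + B).
Proof.
  intros T. pose proof (triangle_sum _ _ _ _ _ _ T) as S. open_triangle T.
  apply (apex_form_of_sum z1 z2 z3) in S; trivial.
  apply (conic_apex_iff z1 z2) in on_3; trivial. lra.
Qed.

(** In complex notation the pole [W] of the chord [z1 z2] satisfies
    [z1 z2 = W / conjugate W] and [z1 + z2 = 2 / conjugate W]. *)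
Lemma apex_conj (z1 z2 W : point) :
  dot z1 z1 = 1 -> dot z2 z2 = 1 -> 1 + dot z1 z2 <> 0 -> scale (1 + dot z1 z2) W = add z1 z2 ->
  cmul (cmul z1 z2) (conjugate W) = W /\ cmul (add z1 z2) (conjugate W) = (2, 0).
Proof.
  intros H1 H2 D E.
  assert (EW : W = scale (/ (1 + dot z1 z2)) (add z1 z2)).
  { rewrite <- E. apply injective_projections; coords; field; trivial. }
  assert (C1 : cmul (cmul z1 z2) (conjugate (add z1 z2)) = add z1 z2).
  { transitivity (add (scale (dot z1 z1) z2) (scale (dot z2 z2) z1)).
    - coords. f_equal; ring.
    - rewrite H1, H2. coords. f_equal; ring. }
  assert (C2 : cmul (add z1 z2) (conjugate (add z1 z2)) = (2 * (1 + dot z1 z2), 0)).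
  { transitivity (dot z1 z1 + dot z2 z2 + 2 * dot z1 z2, 0).
    - coords. f_equal; ring.
    - rewrite H1, H2. f_equal; ring. }
  split.
  - transitivity (scale (/ (1 + dot z1 z2)) (cmul (cmul z1 z2) (conjugate (add z1 z2)))).
    + rewrite EW at 1. generalize (/ (1 + dot z1 z2)). intros. coords. f_equal; ring.
    + rewrite C1. symmetry. exact EW.
  - transitivity (scale (/ (1 + dot z1 z2)) (cmul (add z1 z2) (conjugate (add z1 z2)))).
    + rewrite EW at 1. generalize (/ (1 + dot z1 z2)). intros. coords. f_equal; ring.
    + rewrite C2. unfold scale. cbn [fst snd]. f_equal; field; trivial.
Qed.

(** The vertices lie on one circle, depending only on the sum of the contact
    points.  Inversion in the unit circle carries the vertices to the midpoints of
    the sides of the contact triangle, hence the circumcircle to the nine-point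
    circle of that triangle, with center [(z1 + z2 + z3) / 2] and radius [1 / 2]. *)
Lemma apex_circle (z1 z2 z3 W : point) :
  dot z1 z1 = 1 -> dot z2 z2 = 1 -> dot z3 z3 = 1 -> 1 + dot z1 z2 <> 0 ->
  scale (1 + dot z1 z2) W = add z1 z2 ->
  (1 - dot (sum3 z1 z2 z3) (sum3 z1 z2 z3)) * dot W W + 4 * dot W (sum3 z1 z2 z3) = 4.
Proof.
  intros H1 H2 H3 D E.
  assert (N : dot (add z1 z2) (add z1 z2) = 2 * (1 + dot z1 z2)).
  { transitivity (dot z1 z1 + dot z2 z2 + 2 * dot z1 z2); [coords; ring|]. rewrite H1, H2. ring. }
  assert (S : dot (sum3 z1 z2 z3) (sum3 z1 z2 z3) =
              dot (add z1 z2) (add z1 z2) + dot z3 z3 + 2 * dot (add z1 z2) z3) by (coords; ring).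
  assert (WW : (1 + dot z1 z2) * dot W W = 2).
  { apply (Rmult_eq_reg_l (1 + dot z1 z2)); trivial.
    transitivity (dot (scale (1 + dot z1 z2) W) (scale (1 + dot z1 z2) W)); [coords; ring|].
    rewrite E, N. ring. }
  assert (WS : (1 + dot z1 z2) * dot W (sum3 z1 z2 z3) =
               2 * (1 + dot z1 z2) + dot (add z1 z2) z3).
  { transitivity (dot (scale (1 + dot z1 z2) W) (sum3 z1 z2 z3)); [coords; ring|].
    rewrite E, <- N. coords; ring. }
  apply (Rmult_eq_reg_l (1 + dot z1 z2)); trivial.
  rewrite S, N, H3. set (k := dot (add z1 z2) z3) in *.
  transitivity ((- 2 * (1 + dot z1 z2) - 2 * k) * ((1 + dot z1 z2) * dot W W)
                + 4 * ((1 + dot z1 z2) * dot W (sum3 z1 z2 z3))); [ring|].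
  rewrite WW, WS. ring.
Qed.

(** * The triangle with a given vertex *)

Definition opposite_denominator (W : point) : R := ((1 - v) * fst W) ^ 2 + ((1 + v) * snd W) ^ 2.

(** Eliminating [z2] and [z3] from [triangle_sum] by [apex_conj] leaves
    [z1 = (u conjugate W - 2) / (conjugate W - v W)] for the contact point [z1]
    on the side opposite to the vertex [W].  The contact points are thus rational
    functions of the vertices, and can be differentiated along with them. *)
Definition opposite_contact (W : point) : point :=
  scale (/ opposite_denominator W)
    (cmul (sub (cmul u (conjugate W)) (2, 0)) ((1 - v) * fst W, (1 + v) * snd W)).

Lemma opposite_contact_unique (W z : point) :
  opposite_denominator W <> 0 ->
  cmul z (sub (conjugate W) (scale v W)) = sub (cmul u (conjugate W)) (2, 0) -> z = opposite_contact W.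
Proof.
  intros D E. unfold opposite_contact. rewrite <- E.
  unfold opposite_denominator in *. apply injective_projections; coords; field; trivial.
Qed.

Lemma opposite_contact_equation (W : point) :
  opposite_denominator W <> 0 ->
  cmul (opposite_contact W) (sub (conjugate W) (scale v W)) = sub (cmul u (conjugate W)) (2, 0).
Proof.
  intros D. unfold opposite_contact. unfold opposite_denominator in *. apply injective_projections; coords; field; trivial.
Qed.

(** The data of a Poncelet family in normalized coordinates: an ellipse around the unit
    circle for which Cayley's condition holds. *)
Record poncelet_normal_form : Prop := {
  A_pos : 0 < A; A_lt_B : A < B; B_lt_1 : B < 1;
  inside : forall z, dot z z = 1 -> conic z < 0;
  cayley_eq : dot u u = 1 + v ^ 2 - 2 * (A + B) }.

Lemma tangent_rotate z1 z2 z3 W1 W2 W3 :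
  tangent_triangle z1 z2 z3 W1 W2 W3 -> tangent_triangle z2 z3 z1 W2 W3 W1.
Proof. intros []; constructor; trivial. Qed.

Context (H : poncelet_normal_form).

Lemma v_bounds : 0 < v < 1.
Proof. destruct H. unfold v. lra. Qed.

Lemma opposite_denominator_pos (z W : point) : dot z W = 1 -> 0 < opposite_denominator W.
Proof.
  intros E. pose proof v_bounds. unfold opposite_denominator.
  assert (N : fst W <> 0 \/ snd W <> 0).
  { destruct (Req_dec (fst W) 0) as [X|]; [right|tauto]. intros Y. coords.
    rewrite X, Y in E. lra. }
  rewrite <- !Rsqr_pow2.
  destruct N as [N|N].
  - apply Rplus_lt_le_0_compat; [apply Rsqr_pos_lt, Rmult_integral_contrapositive; lra|apply Rle_0_sqr].
  - apply Rplus_le_lt_0_compat; [apply Rle_0_sqr|apply Rsqr_pos_lt, Rmult_integral_contrapositive; lra].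
Qed.

Lemma tangent_opposite z1 z2 z3 W1 W2 W3 :
  tangent_triangle z1 z2 z3 W1 W2 W3 -> z1 = opposite_contact W1.
Proof.
  intros T. pose proof (triangle_sum _ _ _ _ _ _ T) as S. open_triangle T.
  destruct (apex z2 z3 W1) as [D E]; trivial.
  apply apex_conj in E as [E1 E2]; trivial.
  apply opposite_contact_unique.
  { apply Rgt_not_eq, (opposite_denominator_pos z2); trivial. }
  transitivity (sub (cmul z1 (conjugate W1)) (scale v (cmul z1 W1))).
  { coords. f_equal; ring. }
  rewrite <- E1 at 2.
  replace (scale v (cmul z1 (cmul (cmul z2 z3) (conjugate W1))))
     with (cmul (scale v (cmul3 z1 z2 z3)) (conjugate W1)) by (coords; f_equal; ring).
  replace (scale v (cmul3 z1 z2 z3)) with (sub (sum3 z1 z2 z3) u).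
  - rewrite <- E2. coords. f_equal; ring.
  - rewrite S. coords. f_equal; ring.
Qed.

Definition vertex (z1 z2 : point) : point := scale (/ (1 + dot z1 z2)) (add z1 z2).

Lemma vertex_incident z1 z2 :
  dot z1 z1 = 1 -> dot z2 z2 = 1 -> 1 + dot z1 z2 <> 0 ->
  dot z1 (vertex z1 z2) = 1 /\ dot z2 (vertex z1 z2) = 1.
Proof.
  intros H1 H2 D. split.
  - transitivity ((dot z1 z1 + dot z1 z2) / (1 + dot z1 z2)).
    + unfold vertex. generalize (1 + dot z1 z2) D. intros. coords. field; trivial.
    + rewrite H1. field; trivial.
  - transitivity ((dot z2 z2 + dot z1 z2) / (1 + dot z1 z2)).
    + unfold vertex. generalize (1 + dot z1 z2) D. intros. coords. field; trivial.
    + rewrite H2. field; trivial.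
Qed.

(** A double contact point would lie on the conic, which encloses the circle; for an
    antipodal pair the condition reads [v x = A + B] with [x <= 1], but
    [v = B - A]. *)
Lemma apex_form_generic z1 z2 :
  dot z1 z1 = 1 -> dot z2 z2 = 1 -> apex_form z1 z2 = A + B - 1 ->
  z1 <> z2 /\ 1 + dot z1 z2 <> 0.
Proof.
  intros H1 H2 C. split.
  - intros <-. pose proof (inside H z1 H1) as I.
    pose proof (conic_apex z1 z1 z1 H1 H1) as F. rewrite H1, C in F.
    cut (conic z1 = 0); [lra|].
    cut ((1 + 1) * conic z1 = 0); [lra|]. rewrite F; [lra|lra|]. coords. f_equal; ring.
  - intros D. pose proof (unit_sum_squares z1 z2 H1 H2) as [S1 S2].
    rewrite D, Rmult_0_l, <- Rsqr_pow2 in S1, S2. apply Rsqr_0_uniq in S1, S2.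
    pose proof v_bounds. pose proof (A_pos H).
    assert (X : fst (cmul z1 z2) = - (fst z1 * fst z1 - snd z1 * snd z1)).
    { coords. replace (fst z2) with (- fst z1) by lra. replace (snd z2) with (- snd z1) by lra. ring. }
    assert (U : dot u (add z1 z2) = 0).
    { unfold dot. rewrite S1, S2. ring. }
    unfold apex_form in C. rewrite U, X in C. unfold dot at 1 in H1.
    unfold v in *. nra.
Qed.

(** Poncelet's porism for this family: the relation is symmetric in the contact
    points, so Cayley's condition puts all three vertices on the conic at once. *)
Lemma triangle_of_sum z1 z2 z3 :
  dot z1 z1 = 1 -> dot z2 z2 = 1 -> dot z3 z3 = 1 ->
  sum3 z1 z2 z3 = add u (scale v (cmul3 z1 z2 z3)) ->
  tangent_triangle z1 z2 z3 (vertex z2 z3) (vertex z3 z1) (vertex z1 z2).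
Proof.
  intros H1 H2 H3 S.
  assert (C : forall a b c, dot a a = 1 -> dot b b = 1 -> dot c c = 1 ->
     sum3 a b c = add u (scale v (cmul3 a b c)) -> apex_form a b = A + B - 1).
  { intros a b c Ha Hb Hc E. apply apex_form_of_sum in E; trivial.
    rewrite (cayley_eq H) in E. lra. }
  assert (S' : sum3 z2 z3 z1 = add u (scale v (cmul3 z2 z3 z1))).
  { transitivity (sum3 z1 z2 z3); [coords; f_equal; ring|]. rewrite S. coords. f_equal; ring. }
  assert (S'' : sum3 z3 z1 z2 = add u (scale v (cmul3 z3 z1 z2))).
  { transitivity (sum3 z1 z2 z3); [coords; f_equal; ring|]. rewrite S. coords. f_equal; ring. }
  apply C in S, S', S''; trivial. clear C.
  destruct (apex_form_generic z1 z2), (apex_form_generic z2 z3), (apex_form_generic z3 z1); trivial.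
  destruct (vertex_incident z1 z2), (vertex_incident z2 z3), (vertex_incident z3 z1); trivial.
  constructor; trivial; [apply (conic_apex_iff z2 z3)|apply (conic_apex_iff z3 z1)|apply (conic_apex_iff z1 z2)]; trivial.
Qed.

(** For [s = tangent_length W] and its opposite these are the contact points of the
    two tangents from [W], the numbers [W (1 + i s) / |W| ^ 2]. *)
Definition tangent_contact (s : R) (W : point) : point :=
  scale (/ dot W W) (fst W - s * snd W, snd W + s * fst W).

Definition tangent_length (W : point) : R := sqrt (dot W W - 1).

Lemma tangent_contact_incident s W : dot W W <> 0 -> dot (tangent_contact s W) W = 1.
Proof. intros D. unfold tangent_contact. coords. field; trivial. Qed.

Lemma tangent_contact_unit s W : dot W W <> 0 -> s * s = dot W W - 1 ->
  dot (tangent_contact s W) (tangent_contact s W) = 1.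
Proof.
  intros D E. transitivity ((1 + s * s) / dot W W).
  - unfold tangent_contact. coords. field; trivial.
  - rewrite E. field; trivial.
Qed.

Lemma tangent_length_sqr W : 1 < dot W W -> tangent_length W * tangent_length W = dot W W - 1.
Proof. intros. apply sqrt_sqrt. lra. Qed.

Lemma tangent_length_pos W : 1 < dot W W -> 0 < tangent_length W.
Proof. intros. apply sqrt_lt_R0. lra. Qed.

(** Along the diameter through [W] the conic's equation is a quadratic polynomial with
    nonnegative leading coefficient, negative at both ends of the diameter and hence
    on all of it. *)
Lemma conic_outside (W : point) : conic W = 0 -> 1 < dot W W.
Proof.
  intros C. destruct (Rlt_or_le 1 (dot W W)) as [|L]; trivial. exfalso.
  destruct (Req_dec (dot W W) 0) as [Z|Z].
  { apply dot_self_eq0 in Z. subst. unfold conic in C. coords. lra. }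
  assert (P : 0 < dot W W) by (coords; nra).
  set (k := sqrt (dot W W)). assert (K : k * k = dot W W) by (apply sqrt_sqrt; lra).
  assert (Kp : 0 < k) by (apply sqrt_lt_R0; trivial).
  assert (I1 : dot (scale (/ k) W) (scale (/ k) W) = 1).
  { transitivity (dot W W / (k * k)); [coords; field; lra|]. rewrite K. field; trivial. }
  assert (I2 : dot (scale (- / k) W) (scale (- / k) W) = 1).
  { rewrite <- I1. coords; ring. }
  apply (inside H) in I1, I2. unfold conic in *.
  assert (E1 : A * fst (scale (/ k) W) ^ 2 + B * snd (scale (/ k) W) ^ 2 =
               (A * fst W ^ 2 + B * snd W ^ 2) / (k * k)) by (coords; field; lra).
  assert (E2 : A * fst (scale (- / k) W) ^ 2 + B * snd (scale (- / k) W) ^ 2 =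
               (A * fst W ^ 2 + B * snd W ^ 2) / (k * k)) by (coords; field; lra).
  assert (E3 : dot u (scale (/ k) W) = dot u W / k) by (coords; field; lra).
  assert (E4 : dot u (scale (- / k) W) = - (dot u W / k)) by (coords; field; lra).
  rewrite E1, E3 in I1. rewrite E2, E4 in I2.
  set (q := A * fst W ^ 2 + B * snd W ^ 2) in *.
  set (l := dot u W) in *.
  assert (k <= 1) by nra.
  assert (Q : q / (k * k) * (k * k) = q) by (field; lra).
  assert (L' : l / k * k = l) by (field; lra).
  assert (Qp : 0 <= q / (k * k)).
  { apply Rmult_le_pos; [|left; apply Rinv_0_lt_compat; nra].
    pose proof (A_pos H). pose proof (A_lt_B H).
    pose proof (pow2_ge_0 (fst W)). pose proof (pow2_ge_0 (snd W)). unfold q. nra. }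
  set (q' := q / (k * k)) in *. set (l' := l / k) in *. clearbody q' l'.
  assert ((1 + k) * (q' + l' - 1) <= 0) by nra.
  assert ((1 - k) * (q' + - l' - 1) <= 0) by nra.
  assert (q' * (k * k) <= q') by nra.
  assert (X : (1 + k) * (q' + l' - 1) + (1 - k) * (q' + - l' - 1) < 0) by nra. nra.
Qed.

(** [|u conjugate W - 2|] and [|conjugate W - v W|] agree on the conic because of
    Cayley's condition. *)
Lemma opposite_contact_unit (W : point) :
  conic W = 0 -> opposite_denominator W <> 0 ->
  dot (opposite_contact W) (opposite_contact W) = 1.
Proof.
  intros C D.
  transitivity (dot (sub (cmul u (conjugate W)) (2, 0)) (sub (cmul u (conjugate W)) (2, 0)) / opposite_denominator W).
  { unfold opposite_contact. unfold opposite_denominator in *. coords. field; trivial. }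
  replace (dot (sub (cmul u (conjugate W)) (2, 0)) (sub (cmul u (conjugate W)) (2, 0))) with (opposite_denominator W).
  { field; trivial. }
  transitivity (dot u u * dot W W - 4 * dot u W + 4); [|coords; ring].
  rewrite (cayley_eq H). unfold conic in C. replace (dot u W) with (1 - A * fst W ^ 2 - B * snd W ^ 2) by lra.
  unfold opposite_denominator, v. coords. ring.
Qed.

(** Every point of the conic is a vertex of a triangle: two contact points come from
    the tangents through it, the third from [opposite_contact]. *)
Lemma triangle_at_apex (W : point) :
  conic W = 0 ->
  tangent_triangle (opposite_contact W)
    (tangent_contact (tangent_length W) W) (tangent_contact (- tangent_length W) W)
    W (vertex (tangent_contact (- tangent_length W) W) (opposite_contact W))
    (vertex (opposite_contact W) (tangent_contact (tangent_length W) W)).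
Proof.
  intros C. pose proof (conic_outside W C) as O. pose proof (tangent_length_sqr W O) as T2.
  pose proof (tangent_length_pos W O) as TP.
  assert (W0 : dot W W <> 0) by lra.
  pose proof (tangent_contact_incident (tangent_length W) W W0) as I1.
  pose proof (tangent_contact_incident (- tangent_length W) W W0) as I2.
  pose proof (tangent_contact_unit (tangent_length W) W W0 T2) as U1.
  assert (U2 : dot (tangent_contact (- tangent_length W) W) (tangent_contact (- tangent_length W) W) = 1) by (apply tangent_contact_unit; lra).
  pose proof (opposite_denominator_pos _ _ I1) as D. apply Rgt_not_eq in D.
  pose proof (opposite_contact_unit W C D) as U3.
  assert (T : tangent_triangle (opposite_contact W) (tangent_contact (tangent_length W) W) (tangent_contact (- tangent_length W) W)
    (vertex (tangent_contact (tangent_length W) W) (tangent_contact (- tangent_length W) W)) (vertex (tangent_contact (- tangent_length W) W) (opposite_contact W)) (vertex (opposite_contact W) (tangent_contact (tangent_length W) W))).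
  { apply triangle_of_sum; trivial.
    assert (P : cmul (tangent_contact (tangent_length W) W) (tangent_contact (- tangent_length W) W) = scale (/ dot W W) (cmul W W)).
    { transitivity (scale ((1 + tangent_length W * tangent_length W) / (dot W W * dot W W)) (cmul W W)).
      - unfold tangent_contact. generalize (tangent_length W). intros t. coords. f_equal; field; trivial.
      - rewrite T2. unfold scale. f_equal; field; trivial. }
    assert (S : add (tangent_contact (tangent_length W) W) (tangent_contact (- tangent_length W) W) = scale (2 / dot W W) W).
    { unfold tangent_contact. generalize (tangent_length W). intros t. coords. f_equal; field; trivial. }
    pose proof (opposite_contact_equation W D) as E. set (z := opposite_contact W) in *.
    assert (Q : cmul3 z (tangent_contact (tangent_length W) W) (tangent_contact (- tangent_length W) W) = cmul z (scale (/ dot W W) (cmul W W))).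
    { rewrite <- P. unfold cmul3. coords. f_equal; ring. }
    assert (Q' : sum3 z (tangent_contact (tangent_length W) W) (tangent_contact (- tangent_length W) W) = add z (scale (2 / dot W W) W)).
    { rewrite <- S. coords. f_equal; ring. }
    rewrite Q, Q'. clear Q Q'.
    assert (E' : cmul (cmul z (sub (conjugate W) (scale v W))) (scale (/ dot W W) W) =
                 cmul (sub (cmul u (conjugate W)) (2, 0)) (scale (/ dot W W) W)) by now rewrite E.
    assert (E1 : cmul (cmul z (sub (conjugate W) (scale v W))) (scale (/ dot W W) W) =
       sub z (scale v (cmul z (scale (/ dot W W) (cmul W W))))).
    { clear - W0. apply injective_projections; coords; field; trivial. }
    assert (E2 : cmul (sub (cmul u (conjugate W)) (2, 0)) (scale (/ dot W W) W) =
       sub u (scale (2 / dot W W) W)).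
    { clear - W0. apply injective_projections; coords; field; trivial. }
    rewrite E1, E2 in E'. clear - E'.
    set (p := scale v _) in *. set (q := scale (2 / _) W) in *. clearbody p q z.
    coords. injection E'. intros. f_equal; lra. }
  assert (EV : vertex (tangent_contact (tangent_length W) W) (tangent_contact (- tangent_length W) W) = W).
  { open_triangle T. destruct (apex (tangent_contact (tangent_length W) W) (tangent_contact (- tangent_length W) W) W) as [D' E']; trivial.
    unfold vertex. rewrite <- E'. apply injective_projections; coords; field; trivial. }
  now rewrite EV in T.
Qed.

(** * The circle of contact sums *)

Lemma sum_on_circle z1 z2 z3 W1 W2 W3 :
  tangent_triangle z1 z2 z3 W1 W2 W3 ->
  dot (sub (sum3 z1 z2 z3) u) (sub (sum3 z1 z2 z3) u) = v ^ 2.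
Proof.
  intros T. pose proof (triangle_sum _ _ _ _ _ _ T) as S. open_triangle T.
  assert (E : sub (sum3 z1 z2 z3) u = scale v (cmul3 z1 z2 z3)).
  { rewrite S. coords. f_equal; ring. }
  rewrite E. transitivity (v ^ 2 * (dot z1 z1 * dot z2 z2 * dot z3 z3)); [coords; ring|].
  rewrite unit_1, unit_2, unit_3. ring.
Qed.

(** Cayley's condition is [|u| ^ 2 = (1 - v) ^ 2 - 4 A], so [|u| + v < 1].  For the
    contact triangle this means that its orthocenter is inside the unit circle, that
    is, that the triangle is acute. *)
Lemma circle_in_disk (s : point) : dot (sub s u) (sub s u) = v ^ 2 -> dot s s < 1.
Proof.
  intros E. pose proof v_bounds as V. pose proof (A_pos H) as Ap.
  assert (U : dot u u < (1 - v) ^ 2).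
  { rewrite (cayley_eq H). unfold v in *. lra. }
  assert (S : dot s s = dot u u + 2 * dot u (sub s u) + dot (sub s u) (sub s u)) by (coords; ring).
  assert (P : 0 <= dot (sub (scale (1 - v) (sub s u)) (scale v u)) (sub (scale (1 - v) (sub s u)) (scale v u))).
  { apply dot_self_ge0. }
  replace (dot (sub (scale (1 - v) (sub s u)) (scale v u)) (sub (scale (1 - v) (sub s u)) (scale v u)))
   with ((1 - v) ^ 2 * dot (sub s u) (sub s u) - 2 * (1 - v) * v * dot u (sub s u) + v ^ 2 * dot u u) in P
   by (coords; ring).
  rewrite E in *. rewrite S. clear S E. set (d := dot u (sub s u)) in *.
  set (n := dot u u) in *. clearbody d n v.
  assert (v ^ 2 * n < v ^ 2 * (1 - v) ^ 2) by (apply Rmult_lt_compat_l; nra).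
  assert (v * ((1 - v) * d) < v * ((1 - v) * ((1 - v) * v))) by nra.
  assert (d < (1 - v) * v).
  { apply (Rmult_lt_reg_l (v * (1 - v))); nra. }
  nra.
Qed.

(** With [s = u + v l] and [|l| = 1], the contact points should be the roots of
    [z ^ 3 - s z ^ 2 + l conjugate(s) z - l].  With [l = exp(2 i w)] and
    [z = exp(2 i al)] a root amounts to a zero of a real function of [al], which
    changes sign because [|s| < 1].  One unit root [z1] suffices: with
    [f = exp(i (w - al))] the other two have the product [f ^ 2] and the sum
    [rho f], where [|rho| < 2], so they are the unit numbers
    [f (rho / 2 + i t)] and [f (rho / 2 - i t)]. *)
Lemma triangle_with_sum (s : point) :
  dot (sub s u) (sub s u) = v ^ 2 ->
  exists z1 z2 z3 W1 W2 W3, tangent_triangle z1 z2 z3 W1 W2 W3 /\ sum3 z1 z2 z3 = s.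
Proof.
  intros E. pose proof (circle_in_disk s E) as D. pose proof v_bounds as V.
  assert (L : dot (scale (/ v) (sub s u)) (scale (/ v) (sub s u)) = 1).
  { transitivity (dot (sub s u) (sub s u) / v ^ 2); [|rewrite E; field; lra].
    generalize (sub s u). intros. coords. field. lra. }
  destruct (unit_angle _ L) as [w2 Lw].
  (* half angles, so that the cubic becomes a real equation *)
  set (w := w2 / 2).
  set (g := fun al => sin (3 * al - w) - (fst s * sin (al - w) + snd s * cos (al - w))).
  assert (Gb : forall al, Rabs (fst s * sin (al - w) + snd s * cos (al - w)) < 1).
  { intros al. apply (dot_unit_lt s (sin (al - w), cos (al - w))); trivial.
    unfold dot. cbn [fst snd]. pose proof (sin2_cos2 (al - w)). unfold Rsqr in *. lra. }
  (* at these two angles the sine of [3 * al - w] is -1 and 1 *)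
  destruct (IVT g ((w - PI / 2) / 3) ((w + PI / 2) / 3)) as [al [_ Z]].
  { unfold g. intros x. apply derivable_continuous_pt.
    apply ex_derive_Reals_0. auto_derive; trivial. }
  { pose proof PI_RGT_0. lra. }
  { unfold g. replace (3 * ((w - PI / 2) / 3) - w) with (- (PI / 2)) by field.
    rewrite sin_neg, sin_PI2. pose proof (Gb ((w - PI / 2) / 3)) as G. apply Rabs_def2 in G. lra. }
  { unfold g. replace (3 * ((w + PI / 2) / 3) - w) with (PI / 2) by field.
    rewrite sin_PI2. pose proof (Gb ((w + PI / 2) / 3)) as G. apply Rabs_def2 in G. lra. }
  set (z1 := (cos (2 * al), sin (2 * al)) : point).
  set (f := (cos (w - al), sin (w - al)) : point).
  assert (U1 : dot z1 z1 = 1).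
  { unfold z1, dot. cbn [fst snd]. pose proof (sin2_cos2 (2 * al)). unfold Rsqr in *. lra. }
  assert (Uf : dot f f = 1).
  { unfold f, dot. cbn [fst snd]. pose proof (sin2_cos2 (w - al)). unfold Rsqr in *. lra. }
  (* the root equation says that [s - z1] is a real multiple of [f] *)
  set (rho := fst (cmul (conjugate f) (sub s z1))).
  assert (R1 : cmul (conjugate f) (sub s z1) = (rho, 0)).
  { apply injective_projections; trivial. cbn [snd].
    transitivity (- g al); [|rewrite Z; ring].
    unfold g, f, z1.
    replace (3 * al - w) with (2 * al - (w - al)) by ring.
    replace (al - w) with (- (w - al)) by ring.
    rewrite (sin_minus (2 * al)), sin_neg, cos_neg. coords. ring. }
  assert (R2 : sub s z1 = scale rho f).
  { transitivity (cmul f (cmul (conjugate f) (sub s z1))).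
    - transitivity (scale (dot f f) (sub s z1)); [|coords; f_equal; ring].
      rewrite Uf. coords. f_equal; ring.
    - rewrite R1. coords. f_equal; ring. }
  assert (R3 : rho * rho < 4).
  { assert (X : dot (sub s z1) (sub s z1) = rho * rho).
    { rewrite R2. transitivity (rho * rho * dot f f); [coords; ring|]. rewrite Uf. ring. }
    rewrite <- X. pose proof (dot_unit_lt s z1 D U1) as Y. apply Rabs_def2 in Y.
    assert (dot (sub s z1) (sub s z1) = dot s s - 2 * dot s z1 + dot z1 z1) by (coords; ring).
    lra. }
  set (t := sqrt (1 - rho * rho / 4)).
  assert (T2 : t * t = 1 - rho * rho / 4) by (apply sqrt_sqrt; lra).
  set (z2 := cmul f (rho / 2, t)). set (z3 := cmul f (rho / 2, - t)).
  assert (U2 : dot z2 z2 = 1).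
  { transitivity (dot f f * (rho * rho / 4 + t * t)); [unfold z2; clearbody f t; coords; field|]. rewrite Uf, T2. field. }
  assert (U3 : dot z3 z3 = 1).
  { transitivity (dot f f * (rho * rho / 4 + t * t)); [unfold z3; clearbody f t; coords; field|]. rewrite Uf, T2. field. }
  assert (S : sum3 z1 z2 z3 = s).
  { transitivity (add z1 (scale rho f)).
    - unfold z2, z3. clearbody f z1 t. coords. f_equal; field.
    - rewrite <- R2. apply injective_projections; coords; ring. }
  assert (P : cmul3 z1 z2 z3 = (cos w2, sin w2)).
  { transitivity (cmul z1 (scale (rho * rho / 4 + t * t) (cmul f f))).
    { unfold z2, z3. clearbody f z1 t. coords. f_equal; field. }
    rewrite T2. transitivity (cmul (cmul z1 f) f).
    { clearbody f z1. coords. f_equal; field. }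
    unfold z1, f. coords.
    replace w2 with ((2 * al + (w - al)) + (w - al)) by (unfold w; field).
    rewrite (cos_plus (2 * al + (w - al))), (sin_plus (2 * al + (w - al))), cos_plus, sin_plus.
    f_equal; ring. }
  exists z1, z2, z3, (vertex z2 z3), (vertex z3 z1), (vertex z1 z2). split; trivial.
  apply triangle_of_sum; trivial. rewrite S, P, <- Lw.
  apply injective_projections; coords; field; lra.
Qed.

(** * The contact sum never rests *)

(** By [triangle_sum] the product of the contact points is a function of their sum,
    so it is stationary as well. *)
Lemma contacts_at_rest (z1 z2 z3 : R -> point) (t : R) :
  (forall s, dot (z1 s) (z1 s) = 1) -> (forall s, dot (z2 s) (z2 s) = 1) ->
  (forall s, dot (z3 s) (z3 s) = 1) ->
  (forall s, sum3 (z1 s) (z2 s) (z3 s) = add u (scale v (cmul3 (z1 s) (z2 s) (z3 s)))) ->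
  z1 t <> z2 t -> z2 t <> z3 t -> z3 t <> z1 t ->
  ex_derive_point z1 t -> ex_derive_point z2 t -> ex_derive_point z3 t ->
  velocity (fun s => sum3 (z1 s) (z2 s) (z3 s)) t = (0, 0) ->
  velocity z1 t = (0, 0) /\ velocity z2 t = (0, 0) /\ velocity z3 t = (0, 0).
Proof.
  intros U1 U2 U3 S N12 N23 N31 D1 D2 D3 V.
  pose proof v_bounds as Hv.
  apply (unit_velocities_zero (z1 t) (z2 t) (z3 t)); trivial.
  - now apply unit_velocity.
  - now apply unit_velocity.
  - now apply unit_velocity.
  - rewrite <- V. symmetry. now apply velocity_sum3.
  - rewrite <- velocity_cmul3; trivial.
    assert (E : forall s, cmul3 (z1 s) (z2 s) (z3 s) = scale (/ v) (sub (sum3 (z1 s) (z2 s) (z3 s)) u)).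
    { intros s. rewrite S. apply injective_projections; coords; field; lra. }
    rewrite (velocity_ext _ _ t E).
    assert (D : ex_derive_point (fun s => sum3 (z1 s) (z2 s) (z3 s)) t).
    { now apply sum3_differentiable. }
    set (F := fun s => sum3 (z1 s) (z2 s) (z3 s)) in *.
    assert (X : velocity (fun s => scale (/ v) (sub (F s) u)) t = scale (/ v) (velocity F t)).
    { unfold ex_derive_point in D. apply velocity_unique; unfold velocity; coords; scalarize F; derive_ring. }
    change (velocity (fun s => scale (/ v) (sub (F s) u)) t = (0, 0)).
    rewrite X, V. coords. f_equal; ring.
Qed.

Lemma opposite_contact_differentiable (W : R -> point) t :
  opposite_denominator (W t) <> 0 -> ex_derive_point W t -> ex_derive_point (fun s => opposite_contact (W s)) t.
Proof.
  intros D E. unfold opposite_contact, opposite_denominator, ex_derive_point in *. split; coords; revert D; scalarize W; intros D; auto_derive;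
    repeat split; try tauto; intros X; apply D; rewrite <- X; ring.
Qed.

Definition contact_sum (W1 W2 W3 : point) : point := sum3 (opposite_contact W1) (opposite_contact W2) (opposite_contact W3).

Lemma contact_sum_eq z1 z2 z3 W1 W2 W3 :
  tangent_triangle z1 z2 z3 W1 W2 W3 -> contact_sum W1 W2 W3 = sum3 z1 z2 z3.
Proof.
  intros T. unfold contact_sum.
  rewrite <- (tangent_opposite _ _ _ _ _ _ T).
  rewrite <- (tangent_opposite _ _ _ _ _ _ (tangent_rotate _ _ _ _ _ _ T)).
  rewrite <- (tangent_opposite _ _ _ _ _ _ (tangent_rotate _ _ _ _ _ _ (tangent_rotate _ _ _ _ _ _ T))).
  reflexivity.
Qed.

Lemma tangent_opposite_contacts z1 z2 z3 W1 W2 W3 :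
  tangent_triangle z1 z2 z3 W1 W2 W3 -> tangent_triangle (opposite_contact W1) (opposite_contact W2) (opposite_contact W3) W1 W2 W3.
Proof.
  intros T.
  rewrite <- (tangent_opposite _ _ _ _ _ _ T).
  rewrite <- (tangent_opposite _ _ _ _ _ _ (tangent_rotate _ _ _ _ _ _ T)).
  rewrite <- (tangent_opposite _ _ _ _ _ _ (tangent_rotate _ _ _ _ _ _ (tangent_rotate _ _ _ _ _ _ T))).
  exact T.
Qed.

Lemma contact_sum_differentiable (W1 W2 W3 : R -> point) t :
  tangent_triangle (opposite_contact (W1 t)) (opposite_contact (W2 t)) (opposite_contact (W3 t)) (W1 t) (W2 t) (W3 t) ->
  ex_derive_point W1 t -> ex_derive_point W2 t -> ex_derive_point W3 t ->
  ex_derive_point (fun s => opposite_contact (W1 s)) t /\ ex_derive_point (fun s => opposite_contact (W2 s)) t /\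
  ex_derive_point (fun s => opposite_contact (W3 s)) t /\
  ex_derive_point (fun s => contact_sum (W1 s) (W2 s) (W3 s)) t.
Proof.
  intros Ht D1 D2 D3. open_triangle Ht.
  apply opposite_contact_differentiable in D1, D2, D3;
    try (eapply Rgt_not_eq, opposite_denominator_pos; eassumption).
  split; [trivial|split; [trivial|split; [trivial|]]].
  now apply (sum3_differentiable (fun s => opposite_contact (W1 s)) (fun s => opposite_contact (W2 s)) (fun s => opposite_contact (W3 s))).
Qed.

(** The contact points follow the vertices differentiably and the vertices are
    determined by the contact points, so both come to rest together. *)
Lemma contact_sum_regular (W1 W2 W3 : R -> point) t :
  (forall s, tangent_triangle (opposite_contact (W1 s)) (opposite_contact (W2 s)) (opposite_contact (W3 s))
     (W1 s) (W2 s) (W3 s)) ->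
  ex_derive_point W1 t -> ex_derive_point W2 t -> ex_derive_point W3 t ->
  velocity (fun s => contact_sum (W1 s) (W2 s) (W3 s)) t = (0, 0) ->
  velocity W1 t = (0, 0) /\ velocity W2 t = (0, 0) /\ velocity W3 t = (0, 0).
Proof.
  intros T D1 D2 D3 V.
  destruct (contact_sum_differentiable W1 W2 W3 t (T t) D1 D2 D3) as [E1 [E2 [E3 _]]].
  destruct (contacts_at_rest (fun s => opposite_contact (W1 s)) (fun s => opposite_contact (W2 s)) (fun s => opposite_contact (W3 s)) t)
    as [V1 [V2 V3]]; trivial; try (intros s; destruct (T s); trivial; fail);
    try (destruct (T t); trivial; fail).
  { intros s. apply (triangle_sum _ _ _ _ _ _ (T s)). }
  repeat split.
  - apply (meet_at_rest (fun s => opposite_contact (W2 s)) (fun s => opposite_contact (W3 s))); trivial;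
      try (intros s; destruct (T s); trivial; fail); destruct (T t); trivial.
  - apply (meet_at_rest (fun s => opposite_contact (W3 s)) (fun s => opposite_contact (W1 s))); trivial;
      try (intros s; destruct (T s); trivial; fail); destruct (T t); trivial.
  - apply (meet_at_rest (fun s => opposite_contact (W1 s)) (fun s => opposite_contact (W2 s))); trivial;
      try (intros s; destruct (T s); trivial; fail); destruct (T t); trivial.
Qed.

End Normalized.

(** * Envelopes of polars *)

(** Two equations of one line are proportional; when the line is empty, both linear
    parts vanish. *)
Lemma same_line (a s : point) (M k : R) :
  k <> 0 -> (forall Q, dot a Q + M = 0 <-> dot s Q = k) -> M <> 0 /\ a = scale (- (M / k)) s.
Proof.
  intros K E.
  assert (Mn : M <> 0).
  { intros Z. apply K. rewrite <- (proj1 (E (0, 0))); coords; lra. }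
  split; trivial.
  destruct (Req_dec (dot a a) 0) as [Z|Z].
  - apply dot_self_eq0 in Z. destruct (Req_dec (dot s s) 0) as [Y|Y].
    + apply dot_self_eq0 in Y. subst. coords. f_equal; ring.
    + exfalso. apply Mn. rewrite <- (proj2 (E (scale (k / dot s s) s))).
      * rewrite Z. coords. ring.
      * coords. field; trivial.
  - assert (Q0 : dot s (scale (- (M / dot a a)) a) = k).
    { apply E. coords. field; trivial. }
    assert (Q1 : dot s (add (scale (- (M / dot a a)) a) (- snd a, fst a)) = k).
    { apply E. coords. field; trivial. }
    assert (C : dot s (- snd a, fst a) = 0).
    { transitivity (dot s (add (scale (- (M / dot a a)) a) (- snd a, fst a)) - dot s (scale (- (M / dot a a)) a)).
      - coords; ring.
      - rewrite Q0, Q1. ring. }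
    assert (Q2 : dot s a * M = - k * dot a a).
    { rewrite <- Q0. coords. field; trivial. }
    assert (X : scale (dot a a) s = scale (dot s a) a).
    { transitivity (add (scale (dot s a) a) (scale (dot s (- snd a, fst a)) (- snd a, fst a))).
      - coords. f_equal; ring.
      - rewrite C. coords. f_equal; ring. }
    apply injective_projections.
    + apply (Rmult_eq_reg_l (k * dot a a)); [|now apply Rmult_integral_contrapositive].
      transitivity (- (M * fst (scale (dot a a) s))); [|coords; field; trivial].
      rewrite X. transitivity (- (dot s a * M) * fst a); [rewrite Q2; ring|]. coords; ring.
    + apply (Rmult_eq_reg_l (k * dot a a)); [|now apply Rmult_integral_contrapositive].
      transitivity (- (M * snd (scale (dot a a) s))); [|coords; field; trivial].
      rewrite X. transitivity (- (dot s a * M) * snd a); [rewrite Q2; ring|]. coords; ring.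
Qed.

(** The coefficients are the normalized equation times the differentiable nonvanishing
    factor [M], and such a factor does not change the envelope.  Nonvanishing of
    [M] is the fact that no line of the family passes through [F]. *)
Lemma envelope_of_polars (l m n : R -> R) (s : R -> point) (F : point) (r k : R) :
  r <> 0 -> k <> 0 ->
  (forall t, ex_derive l t /\ ex_derive m t /\ ex_derive n t) ->
  (forall t, ex_derive_point s t) ->
  (forall t P, l t * fst P + m t * snd P + n t = 0 <-> dot (s t) (scale (/ r) (sub P F)) = k) ->
  forall P, envelope l m n P <->
    exists t, dot (s t) (scale (/ r) (sub P F)) = k /\
              dot (velocity s t) (scale (/ r) (sub P F)) = 0.
Proof.
  intros R0 K D Ds E P.
  set (M := fun t => l t * fst F + m t * snd F + n t).
  assert (X : forall t, M t <> 0 /\ (r * l t, r * m t) = scale (- (M t / k)) (s t)).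
  { intros t. apply same_line; trivial. intros Q.
    pose proof (E t (add F (scale r Q))) as EQ.
    replace (scale (/ r) (sub (add F (scale r Q)) F)) with Q in EQ
      by (apply injective_projections; coords; field; trivial).
    rewrite <- EQ. split; intros Y; rewrite <- Y; unfold M; coords; ring. }
  set (Q := scale (/ r) (sub P F)).
  assert (Y : forall t, l t * fst P + m t * snd P + n t = M t * (1 - dot (s t) Q / k)).
  { intros t. destruct (X t) as [Mn Xt].
    transitivity (M t + dot (r * l t, r * m t) Q).
    - unfold M, Q. coords. field; trivial.
    - rewrite Xt. generalize Q. intros. coords. field; trivial. }
  assert (Z : forall t, Derive l t * fst P + Derive m t * snd P + Derive n t =
     Derive M t * (1 - dot (s t) Q / k) - M t * (dot (velocity s t) Q / k)).
  { intros t. destruct (D t) as [Dl [Dm Dn]]. pose proof (Ds t) as Dt.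
    assert (DM : ex_derive M t) by (unfold M; auto_derive; auto).
    apply Rminus_diag_uniq.
    apply (derive_constant (fun t => (l t * fst P + m t * snd P + n t) - M t * (1 - dot (s t) Q / k)) t _ 0).
    { intros x. rewrite Y. ring. }
    clearbody M. unfold ex_derive_point, velocity in *. clear X Y E Ds D. clearbody Q. unfold Rdiv. coords.
    scalarize s. derive_ring. }
  split; intros [t [H1 H2]]; exists t; destruct (X t) as [Mn _].
  - assert (H3 : dot (s t) Q = k) by (now apply E).
    split; trivial. rewrite Z, H3 in H2.
    replace (1 - k / k) with 0 in H2 by (field; trivial).
    apply (Rmult_eq_reg_l (M t / k)).
    + transitivity (- (Derive M t * 0 - M t * (dot (velocity s t) Q / k))); [field; trivial|].
      rewrite H2. ring.
    + unfold Rdiv. apply Rmult_integral_contrapositive. split; trivial. now apply Rinv_neq_0_compat.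
  - split; [now apply E|]. fold Q in H1, H2. rewrite Z, H1, H2. field; trivial.
Qed.

(** Polar reciprocation of a circle.  The velocity is orthogonal to [s - u], so the
    envelope condition makes [Q] a multiple of [s - u], whence
    [|s - u| |Q| = |dot (s - u) Q|]; this is the focus-directrix equation with focus
    at the origin. *)
Lemma envelope_polar_circle (u : point) (v k : R) (s : R -> point) :
  0 < v -> k <> 0 ->
  (forall t, ex_derive_point s t) ->
  (forall t, dot (sub (s t) u) (sub (s t) u) = v ^ 2) ->
  (forall t, velocity s t <> (0, 0)) ->
  (forall e, dot (sub e u) (sub e u) = v ^ 2 -> exists t, s t = e) ->
  forall Q, (exists t, dot (s t) Q = k /\ dot (velocity s t) Q = 0) <->
    v ^ 2 * dot Q Q = (k - dot u Q) ^ 2.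
Proof.
  intros V K D C N S Q.
  assert (O : forall t, dot (velocity s t) (sub (s t) u) = 0).
  { intros t. pose proof (D t) as Dt.
    assert (E : is_derive (fun t => dot (sub (s t) u) (sub (s t) u)) t (2 * dot (velocity s t) (sub (s t) u))).
    { clear N S C D. unfold ex_derive_point, velocity in *. coords. scalarize s. derive_ring. }
    apply (derive_constant _ _ _ _ C) in E. lra. }
  split.
  - intros [t [H1 H2]].
    assert (X : cross (sub (s t) u) Q = 0).
    { destruct (Req_dec (cross (sub (s t) u) Q) 0) as [|Z]; trivial. exfalso. apply (N t).
      apply (dot_zero_basis _ (sub (s t) u) Q); trivial.
      - rewrite <- (O t). unfold dot. ring.
      - rewrite <- H2. unfold dot. ring. }
    rewrite <- (C t). transitivity (dot (sub (s t) u) Q ^ 2 + cross (sub (s t) u) Q ^ 2).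
    + coords; ring.
    + rewrite X, <- H1. coords; ring.
  - intros E. set (m := k - dot u Q) in *.
    assert (Q0 : dot Q Q <> 0).
    { intros Z. apply K. pose proof (dot_self_eq0 Q Z) as Z'. rewrite Z, Rmult_0_r in E.
      assert (m = 0) by nra. unfold m in *. rewrite Z' in *. coords. lra. }
    assert (m0 : m <> 0).
    { intros Z. rewrite Z in E. apply Q0.
      apply (Rmult_eq_reg_l (v ^ 2)); [rewrite E; ring|]. apply pow_nonzero. lra. }
    (* [s - u] must be the multiple of [Q] whose product with [Q] is [m] *)
    destruct (S (add u (scale (m / dot Q Q) Q))) as [t St].
    { transitivity (m ^ 2 / dot Q Q).
      - generalize m. intros. coords. field; trivial.
      - rewrite <- E. field; trivial. }
    exists t. split.
    + rewrite St. transitivity (dot u Q + m).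
      * generalize m. intros. coords. field; trivial.
      * unfold m. ring.
    + pose proof (O t) as Ot. rewrite St in Ot.
      apply (Rmult_eq_reg_l (m / dot Q Q)).
      * rewrite Rmult_0_r, <- Ot. generalize (m / dot Q Q) (velocity s t). intros. coords. ring.
      * unfold Rdiv. apply Rmult_integral_contrapositive. split; trivial. now apply Rinv_neq_0_compat.
Qed.

(** * Conics from their equations *)

Lemma dist_sqr (P Q : point) : dist P Q ^ 2 = dot (sub P Q) (sub P Q).
Proof.
  unfold dist, dist_euc. rewrite <- Rsqr_pow2, Rsqr_sqrt.
  - unfold Rsqr. coords. ring.
  - pose proof (Rle_0_sqr (fst P - fst Q)). pose proof (Rle_0_sqr (snd P - snd Q)). lra.
Qed.

Lemma dist_nonneg (P Q : point) : 0 <= dist P Q.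
Proof. apply sqrt_pos. Qed.

Lemma dist_sym (P Q : point) : dist P Q = dist Q P.
Proof. apply distance_symm. Qed.

Lemma dist_triangle (P Q T : point) : dist P Q <= dist P T + dist T Q.
Proof. apply triangle. Qed.

(** Squaring away the roots in [x + y = 2 s] and in [|x - y| = 2 s], where [x] and
    [y] are the distances from [P] to the foci, leads to the same equation. *)
Definition central_equation (F F' : point) (s : R) (P : point) : Prop :=
  16 * s ^ 2 * dot (sub P F) (sub P F) =
  (4 * s ^ 2 + dot (sub P F) (sub P F) - dot (sub P F') (sub P F')) ^ 2.

(** The triangle inequality decides which factor can vanish: the last two describe an
    ellipse, the first two a hyperbola. *)
Lemma central_equation_factors (F F' : point) (s : R) (P : point) :
  let x := dist P F in let y := dist P F' in
  central_equation F F' s P <->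
  (y - x + 2 * s) * (x - y + 2 * s) * ((x + y - 2 * s) * (x + y + 2 * s)) = 0.
Proof.
  intros x y. unfold central_equation. rewrite <- !dist_sqr. fold x y.
  split; intros E; [transitivity (16 * s ^ 2 * x ^ 2 - (4 * s ^ 2 + x ^ 2 - y ^ 2) ^ 2); [ring|lra]|].
  apply Rminus_diag_uniq. rewrite <- E. ring.
Qed.

Lemma ellipse_of_equation (S : point -> Prop) (F F' : point) (s : R) :
  dist F F' < 2 * s -> (forall P, S P <-> central_equation F F' s P) -> ellipse_with_foci S F F'.
Proof.
  intros L E. exists s. split; trivial. intros P. rewrite E, central_equation_factors.
  pose proof (dist_triangle P F F') as T1. pose proof (dist_triangle P F' F) as T2.
  rewrite (dist_sym F' F) in T1. pose proof (dist_nonneg F F').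
  pose proof (dist_nonneg P F). pose proof (dist_nonneg P F').
  split.
  - intros Z. apply Rmult_integral in Z as [Z|Z]; apply Rmult_integral in Z as [Z|Z]; lra.
  - intros Z. rewrite Z. ring.
Qed.

Lemma hyperbola_of_equation (S : point -> Prop) (F F' : point) (s : R) :
  0 < s -> 2 * s < dist F F' -> (forall P, S P <-> central_equation F F' s P) ->
  hyperbola_with_foci S F F'.
Proof.
  intros Sp L E. exists s. split; [trivial|split; [trivial|]]. intros P.
  rewrite E, central_equation_factors.
  pose proof (dist_triangle F F' P) as T. rewrite (dist_sym F P) in T.
  split.
  - intros Z. unfold Rabs. destruct (Rcase_abs _);
    apply Rmult_integral in Z as [Z|Z]; apply Rmult_integral in Z as [Z|Z]; lra.
  - unfold Rabs. destruct (Rcase_abs _); intros Z.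
    + replace (dist P F - dist P F' + 2 * s) with 0 by lra. ring.
    + replace (dist P F' - dist P F + 2 * s) with 0 by lra. ring.
Qed.

Lemma nonneg_eq_iff_sqr (x y : R) : 0 <= x -> 0 <= y -> (x = y <-> x ^ 2 = y ^ 2).
Proof.
  intros X Y. split; [now intros ->|]. rewrite <- !Rsqr_pow2. now apply Rsqr_inj.
Qed.

Section Focus_directrix.
Context (S : point -> Prop) (F u : point) (v h : R).
Context (v_pos : 0 < v) (h_pos : 0 < h).
Context (eqn : forall P, S P <-> v ^ 2 * dot (sub P F) (sub P F) = (h - dot u (sub P F)) ^ 2).

Let D := v ^ 2 - dot u u.

(** The reflection of [F] in the center of the conic. *)
Definition second_focus : point := sub F (scale (2 * h / (v ^ 2 - dot u u)) u).

(** [central_equation] is the focus-directrix equation multiplied by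
    [(4 * h / D) ^ 2]. *)
Lemma focus_directrix_central (s : R) :
  D <> 0 -> s ^ 2 = (h * v / D) ^ 2 -> forall P, S P <-> central_equation F second_focus s P.
Proof.
  intros D0 E P. rewrite eqn. unfold central_equation. rewrite E.
  set (X := sub P F).
  replace (dot (sub P second_focus) (sub P second_focus)) with
    (dot X X + 4 * h / D * dot u X + 4 * h ^ 2 / D ^ 2 * dot u u).
  2: { unfold X, second_focus. fold D. generalize D D0. intros. coords. field; trivial. }
  replace (4 * (h * v / D) ^ 2 + dot X X - (dot X X + 4 * h / D * dot u X + 4 * h ^ 2 / D ^ 2 * dot u u))
    with (4 * h / D * (h - dot u X)).
  2: { replace (v ^ 2) with (D + dot u u) by (unfold D; ring).
       replace ((h * v / D) ^ 2) with (h ^ 2 * v ^ 2 / D ^ 2) by (field; trivial).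
       replace (v ^ 2) with (D + dot u u) by (unfold D; ring). field; trivial. }
  split; intros Y.
  - transitivity ((4 * h / D) ^ 2 * (v ^ 2 * dot X X)); [field; trivial|]. rewrite Y. ring.
  - apply (Rmult_eq_reg_l ((4 * h / D) ^ 2)).
    + transitivity (16 * (h * v / D) ^ 2 * dot X X); [field; trivial|]. rewrite Y. ring.
    + apply pow_nonzero. unfold Rdiv. apply Rmult_integral_contrapositive. split; [lra|].
      now apply Rinv_neq_0_compat.
Qed.

Lemma second_focus_dist : D <> 0 -> dist F second_focus ^ 2 = (2 * h / D) ^ 2 * dot u u.
Proof.
  intros. rewrite dist_sqr. unfold second_focus. fold D. generalize D H. intros. coords. field; trivial.
Qed.

Lemma focus_directrix_ellipse : dot u u < v ^ 2 -> ellipse_with_foci S F second_focus.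
Proof.
  intros L. assert (Dp : 0 < D) by (unfold D; lra).
  apply ellipse_of_equation with (s := h * v / D).
  - assert (sp : 0 < h * v / D) by (apply Rdiv_lt_0_compat; nra).
    apply Rsqr_incrst_0; [|apply dist_nonneg|lra].
    rewrite Rsqr_pow2, second_focus_dist, Rsqr_pow2 by lra.
    apply Rlt_le_trans with ((2 * h / D) ^ 2 * v ^ 2); [|right; field; lra].
    apply Rmult_lt_compat_l; trivial. apply pow_lt. apply Rdiv_lt_0_compat; lra.
  - apply focus_directrix_central; lra.
Qed.

Lemma focus_directrix_hyperbola : v ^ 2 < dot u u -> hyperbola_with_foci S F second_focus.
Proof.
  intros L. assert (Dp : 0 < - D) by (unfold D; lra).
  assert (sp : 0 < h * v / - D) by (apply Rdiv_lt_0_compat; nra).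
  apply hyperbola_of_equation with (s := h * v / - D); trivial.
  - apply Rsqr_incrst_0; [|lra|apply dist_nonneg].
    rewrite !Rsqr_pow2, second_focus_dist by lra.
    apply Rle_lt_trans with ((2 * h / D) ^ 2 * v ^ 2); [right; field; lra|].
    apply Rmult_lt_compat_l; trivial. apply pow2_gt_0.
    unfold Rdiv. apply Rmult_integral_contrapositive. split; [lra|apply Rinv_neq_0_compat; lra].
  - apply focus_directrix_central; [lra|]. field. lra.
Qed.

(** The directrix is [dot u (P - F) = h], and [v] is the length of [u]. *)
Lemma focus_directrix_parabola :
  dot u u = v ^ 2 -> parabola_with_focus_foot S F (add F (scale (h / v ^ 2) u)).
Proof.
  intros E. assert (vp : v <> 0) by lra.
  assert (d : dist F (add F (scale (h / v ^ 2) u)) = h / v).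
  { apply nonneg_eq_iff_sqr; [apply dist_nonneg|left; apply Rdiv_lt_0_compat; lra|].
    rewrite dist_sqr. transitivity ((h / v ^ 2) ^ 2 * dot u u); [coords; field; lra|].
    rewrite E. field; lra. }
  split.
  - intros X. rewrite <- X in d. pose proof (dist_sqr F F) as Y. rewrite d in Y.
    assert (0 < h / v) by (apply Rdiv_lt_0_compat; lra).
    assert (dot (sub F F) (sub F F) = 0) by (coords; ring). nra.
  - intros P. rewrite eqn, d.
    rewrite (nonneg_eq_iff_sqr (dist P F)); [rewrite dist_sqr|apply dist_nonneg|].
    2: { apply Rmult_le_pos; [apply Rabs_pos|]. left. apply Rinv_0_lt_compat, Rdiv_lt_0_compat; lra. }
    replace ((Rabs ((fst P - fst (add F (scale (h / v ^ 2) u))) * (fst F - fst (add F (scale (h / v ^ 2) u))) +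
     (snd P - snd (add F (scale (h / v ^ 2) u))) * (snd F - snd (add F (scale (h / v ^ 2) u)))) / (h / v)) ^ 2)
     with ((h - dot u (sub P F)) ^ 2 / v ^ 2).
    + split; intros Y.
      * rewrite <- Y. field; lra.
      * rewrite Y. field; lra.
    + set (Z := (fst P - _) * _ + _).
      assert (Ez : Z = h / v ^ 2 * (h - dot u (sub P F))).
      { transitivity (h / v ^ 2 * (h / v ^ 2 * dot u u - dot u (sub P F))).
        - unfold Z. coords. field; lra.
        - rewrite E. field; lra. }
      unfold Rdiv at 2. rewrite Rpow_mult_distr, pow2_abs, Ez. field. lra.
Qed.

End Focus_directrix.

(** * The locus of the normalized circumcenter *)

Section Centers.
Context (A B : R) (u : point) (H : poncelet_normal_form A B u).

Lemma AB_lt_1 : A + B < 1.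
Proof.
  destruct H as [Ap AB B1 _ C]. pose proof (dot_self_ge0 u) as U.
  destruct (Rlt_or_le (A + B) 1) as [|L]; trivial. exfalso. nra.
Qed.

(** The circumcenter is the image of the contact sum under a map that is projective
    on its circle, where [dot s s] is an affine function of [s]; it therefore moves
    on a conic.  The equation is Euler's relation
    [|o| ^ 2 + 1 = (rho - 1) ^ 2] for the circumradius [rho], itself affine in
    [o]. *)
Lemma center_equation (s : point) :
  dot (sub s u) (sub s u) = (B - A) ^ 2 ->
  let o := scale (- (2 / (1 - dot s s))) s in
  (1 - A - B) ^ 2 * (dot o o + 1) = (A + B - dot u o) ^ 2.
Proof.
  intros E o. pose proof (circle_in_disk A B u H s E) as D.
  assert (Us : 2 * dot u s = dot s s - 1 + 2 * (1 - A - B)).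
  { assert (X : dot (sub s u) (sub s u) = dot s s - 2 * dot u s + dot u u) by (coords; ring).
    rewrite X, (cayley_eq _ _ _ H) in E. lra. }
  assert (Oo : dot o o = 4 * dot s s / (1 - dot s s) ^ 2).
  { unfold o. transitivity ((2 / (1 - dot s s)) ^ 2 * dot s s).
    - generalize (2 / (1 - dot s s)). intros. coords. ring.
    - field. lra. }
  assert (Ou : dot u o = - (2 * dot u s) / (1 - dot s s)).
  { unfold o. set (x := dot s s) in *. transitivity (- (2 / (1 - x)) * dot u s).
    - generalize (2 / (1 - x)). intros. coords. ring.
    - field. lra. }
  rewrite Oo, Ou, Us. field. lra.
Qed.

(** The circumradius is recovered from [o] as an affine function [R].  The equation
    is [|o| ^ 2 = R ^ 2 - 2 R], and its branch [R <= 0] is excluded because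
    [|u| <= 1 - A - B]. *)
Lemma center_equation_inv (o : point) :
  (1 - A - B) ^ 2 * (dot o o + 1) = (A + B - dot u o) ^ 2 ->
  exists s, dot (sub s u) (sub s u) = (B - A) ^ 2 /\ o = scale (- (2 / (1 - dot s s))) s.
Proof.
  intros E. pose proof AB_lt_1 as L. pose proof (cayley_eq _ _ _ H) as C.
  destruct H as [Ap AB B1 _ _]. set (e := 1 - A - B) in *.
  assert (ep : 0 < e) by (unfold e; lra).
  set (R := (1 - dot u o) / e).
  assert (Re : R * e = 1 - dot u o) by (unfold R; field; lra).
  assert (Oo : dot o o = R ^ 2 - 2 * R).
  { apply (Rmult_eq_reg_l (e ^ 2)); [|apply pow_nonzero; lra].
    transitivity ((A + B - dot u o) ^ 2 - e ^ 2); [lra|].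
    transitivity ((R * e) ^ 2 - 2 * (R * e) * e); [|ring]. rewrite Re. unfold e. ring. }
  assert (CS : dot u o ^ 2 <= dot u u * dot o o).
  { assert (X : dot u u * dot o o = dot u o ^ 2 + cross u o ^ 2) by (coords; ring).
    pose proof (pow2_ge_0 (cross u o)). lra. }
  assert (U : dot u u <= e ^ 2).
  { rewrite C. unfold e. nra. }
  pose proof (dot_self_ge0 o) as O0.
  assert (Rp : 0 < R).
  { destruct (Rlt_or_le 0 R) as [|Rn]; trivial. exfalso.
    set (y := dot u o) in *. assert (Y : 1 <= y) by nra.
    assert (Z : y ^ 2 <= (R * e) ^ 2 - 2 * (R * e) * e).
    { apply Rle_trans with (dot u u * dot o o); trivial.
      apply Rle_trans with (e ^ 2 * dot o o); [now apply Rmult_le_compat_r|].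
      rewrite Oo. right. ring. }
    rewrite Re in Z. assert (0 < A + B) by lra. unfold e in *. nra. }
  exists (scale (- / R) o).
  assert (S : dot (scale (- / R) o) (scale (- / R) o) = 1 - 2 / R).
  { transitivity (dot o o / R ^ 2); [clearbody R; coords; field; lra|]. rewrite Oo. field. lra. }
  split.
  - transitivity (dot (scale (- / R) o) (scale (- / R) o) + 2 * dot u o / R + dot u u).
    + clearbody R. coords. field. lra.
    + rewrite S, C. replace (dot u o) with (1 - R * e) by lra. unfold e. field. lra.
  - rewrite S. replace (2 / (1 - (1 - 2 / R))) with R by (field; lra).
    clearbody R. apply injective_projections; coords; field; lra.
Qed.

(** The two sides differ by the factor [((B - A) / (A * B)) ^ 2], once [dot u u] is
    eliminated by Cayley's relation. *)
Lemma center_equation_foci (o : point) :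
  (1 - A - B) ^ 2 * (dot o o + 1) = (A + B - dot u o) ^ 2 <->
  central_equation (scale (- / (2 * B)) u) (scale (- / (2 * A)) u)
    ((1 - A - B) * (B - A) / (4 * A * B)) o.
Proof.
  pose proof (cayley_eq _ _ _ H) as C. destruct H as [Ap AB B1 _ _].
  unfold central_equation. set (e := 1 - A - B) in *.
  assert (U : dot u u = e ^ 2 - 4 * A * B) by (rewrite C; unfold e; ring).
  assert (D1 : dot (sub o (scale (- / (2 * B)) u)) (sub o (scale (- / (2 * B)) u)) =
     dot o o + dot u o / B + (e ^ 2 - 4 * A * B) / (4 * B ^ 2)).
  { rewrite <- U. coords. field. lra. }
  assert (D2 : dot (sub o (scale (- / (2 * A)) u)) (sub o (scale (- / (2 * A)) u)) =
     dot o o + dot u o / A + (e ^ 2 - 4 * A * B) / (4 * A ^ 2)).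
  { rewrite <- U. coords. field. lra. }
  rewrite D1, D2. set (x := dot o o). set (y := dot u o).
  assert (K : 16 * (e * (B - A) / (4 * A * B)) ^ 2 * (x + y / B + (e ^ 2 - 4 * A * B) / (4 * B ^ 2)) -
    (4 * (e * (B - A) / (4 * A * B)) ^ 2 + (x + y / B + (e ^ 2 - 4 * A * B) / (4 * B ^ 2)) -
     (x + y / A + (e ^ 2 - 4 * A * B) / (4 * A ^ 2))) ^ 2 =
    ((B - A) / (A * B)) ^ 2 * (e ^ 2 * (x + 1) - (A + B - y) ^ 2)).
  { field. lra. }
  assert (N : ((B - A) / (A * B)) ^ 2 <> 0).
  { apply pow_nonzero. unfold Rdiv. apply Rmult_integral_contrapositive. split; [lra|].
    apply Rinv_neq_0_compat. nra. }
  split; intros Y.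
  - apply Rminus_diag_uniq. rewrite K, Y. ring.
  - apply Rminus_diag_uniq. apply (Rmult_eq_reg_l (((B - A) / (A * B)) ^ 2)); trivial.
    rewrite <- K, Y. ring.
Qed.

Lemma coef_lin_small :
  dot u u < (1 - A - B) ^ 2.
Proof.
  rewrite (cayley_eq _ _ _ H). destruct H as [Ap AB B1 _ _]. nra.
Qed.

End Centers.

(** * Contact points and vertices as functions *)

Lemma tangent_contact_differentiable (s : R -> R) (W : R -> point) (t : R) :
  dot (W t) (W t) <> 0 -> ex_derive s t -> ex_derive_point W t ->
  ex_derive_point (fun x => tangent_contact (s x) (W x)) t.
Proof.
  intros D Ds E. unfold tangent_contact, ex_derive_point in *.
  split; coords; revert D; scalarize W; intros D; auto_derive; tauto.
Qed.

Lemma tangent_length_differentiable (W : R -> point) (t : R) :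
  1 < dot (W t) (W t) -> ex_derive_point W t -> ex_derive (fun x => tangent_length (W x)) t.
Proof.
  intros D E. unfold tangent_length, ex_derive_point in *.
  coords; revert D; scalarize W; intros D; auto_derive; repeat split; try tauto. lra.
Qed.

Lemma vertex_differentiable (z1 z2 : R -> point) (t : R) :
  1 + dot (z1 t) (z2 t) <> 0 -> ex_derive_point z1 t -> ex_derive_point z2 t ->
  ex_derive_point (fun x => vertex (z1 x) (z2 x)) t.
Proof.
  intros D E1 E2. unfold vertex, ex_derive_point in *.
  split; coords; revert D; scalarize z1; scalarize z2; intros D; auto_derive; tauto.
Qed.

Lemma vertex_unique (z1 z2 W : point) :
  dot z1 z1 = 1 -> dot z2 z2 = 1 -> z1 <> z2 -> dot z1 W = 1 -> dot z2 W = 1 -> W = vertex z1 z2.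
Proof.
  intros H1 H2 N W1 W2. destruct (apex z1 z2 W) as [D E]; trivial.
  unfold vertex. rewrite <- E. apply injective_projections; coords; field; trivial.
Qed.

(** [cross W z] is determined up to sign by Lagrange's identity, and [z] by its
    products with [W]. *)
Lemma tangent_contacts (z W : point) :
  1 < dot W W -> dot z z = 1 -> dot z W = 1 ->
  z = tangent_contact (tangent_length W) W \/ z = tangent_contact (- tangent_length W) W.
Proof.
  intros O U I. pose proof (tangent_length_sqr W O) as T.
  assert (X : cross W z ^ 2 = tangent_length W * tangent_length W).
  { rewrite T. transitivity (dot W W * dot z z - dot z W ^ 2); [coords; ring|]. rewrite U, I. ring. }
  assert (Y : z = tangent_contact (cross W z) W).
  { transitivity (scale (/ dot W W) (add (scale (dot z W) W) (scale (cross W z) (- snd W, fst W)))).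
    - coords. apply injective_projections; cbn [fst snd]; field; coords; lra.
    - rewrite I. unfold tangent_contact. coords. f_equal; ring. }
  assert (Z : (cross W z - tangent_length W) * (cross W z + tangent_length W) = 0).
  { transitivity (cross W z ^ 2 - tangent_length W * tangent_length W); [ring|lra]. }
  apply Rmult_integral in Z as [Z|Z]; [left|right].
  - rewrite Y at 1. f_equal. lra.
  - rewrite Y at 1. f_equal. lra.
Qed.

(** * Poncelet triangles in normalized coordinates *)

Section Original.
Context (a b : R) (K : circle).
Context (b_pos : 0 < b) (b_lt_a : b < a) (r_pos : 0 < radius K).
Context (K_inside : forall P : point, on_circle K P -> in_ellipse a b P).

(** Minus the value of the ellipse's equation at the center of the circle; the
    normalizing factor of the conic. *)
Definition depth : R := 1 - ellipse_form a b (center K).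
Definition coef_x : R := radius K ^ 2 / (a ^ 2 * depth).
Definition coef_y : R := radius K ^ 2 / (b ^ 2 * depth).
(** Half the gradient of the ellipse's equation at the center of the circle.  It is the
    common direction of both conics' axes: [focus3], [focus3'] and [polar_focus]
    are the center plus multiples of it. *)
Definition normal_dir : point := (fst (center K) / a ^ 2, snd (center K) / b ^ 2).
Definition coef_lin : point := scale (2 * radius K / depth) normal_dir.

Definition normalize (P : point) : point := scale (/ radius K) (sub P (center K)).
Definition denormalize (W : point) : point := add (center K) (scale (radius K) W).

Notation tangent := (tangent_triangle coef_x coef_y coef_lin).

Lemma denormalize_normalize P : denormalize (normalize P) = P.
Proof. unfold denormalize, normalize. apply injective_projections; coords; field; lra. Qed.

Lemma normalize_denormalize W : normalize (denormalize W) = W.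
Proof. unfold denormalize, normalize. apply injective_projections; coords; field; lra. Qed.

Lemma on_circle_denormalize z : dot z z = 1 -> on_circle K (denormalize z).
Proof.
  intros E. unfold on_circle. apply nonneg_eq_iff_sqr; [apply dist_nonneg|lra|].
  rewrite dist_sqr. transitivity (radius K ^ 2 * dot z z); [unfold denormalize; coords; ring|].
  rewrite E. ring.
Qed.

Lemma normalize_on_circle P : on_circle K P -> dot (normalize P) (normalize P) = 1.
Proof.
  unfold on_circle. intros E. transitivity (dist P (center K) ^ 2 / radius K ^ 2).
  - rewrite dist_sqr. unfold normalize. coords. field. lra.
  - rewrite E. field. lra.
Qed.

Lemma depth_bounds : radius K ^ 2 / a ^ 2 < depth /\ radius K ^ 2 / b ^ 2 < depth.
Proof.
  assert (X : forall z, dot z z = 1 -> radius K ^ 2 * ellipse_form a b z < depth).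
  { intros z U. assert (U' : dot (scale (-1) z) (scale (-1) z) = 1) by (rewrite <- U; coords; ring).
    apply on_circle_denormalize, K_inside in U, U'. unfold in_ellipse in *.
    assert (E : ellipse_form a b (denormalize z) + ellipse_form a b (denormalize (scale (-1) z)) =
      2 * (1 - depth) + 2 * (radius K ^ 2 * ellipse_form a b z)).
    { unfold depth, ellipse_form, denormalize. coords. field. lra. }
    lra. }
  split.
  - specialize (X (1, 0)). replace (radius K ^ 2 / a ^ 2) with (radius K ^ 2 * ellipse_form a b (1, 0)).
    + apply X. coords; ring.
    + unfold ellipse_form. cbn [fst snd]. field. lra.
  - specialize (X (0, 1)). replace (radius K ^ 2 / b ^ 2) with (radius K ^ 2 * ellipse_form a b (0, 1)).
    + apply X. coords; ring.
    + unfold ellipse_form. cbn [fst snd]. field. lra.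
Qed.

Lemma depth_pos : 0 < depth.
Proof.
  destruct depth_bounds as [D _]. apply Rle_lt_trans with (2 := D).
  left. apply Rdiv_lt_0_compat; apply pow_lt; lra.
Qed.

Lemma conic_normalize P : conic coef_x coef_y coef_lin (normalize P) = (ellipse_form a b P - 1) / depth.
Proof.
  pose proof depth_pos as D.
  assert (X : conic coef_x coef_y coef_lin (normalize P) * depth =
    ellipse_form a b P - ellipse_form a b (center K) - depth).
  { unfold conic, coef_x, coef_y, coef_lin, normal_dir, normalize, ellipse_form.
    generalize depth D. intros. coords. field. lra. }
  apply (Rmult_eq_reg_r depth); [|lra]. rewrite X. unfold Rdiv. rewrite Rmult_assoc, Rinv_l by lra.
  unfold depth. ring.
Qed.

Lemma conic_normalize_iff P : conic coef_x coef_y coef_lin (normalize P) = 0 <-> on_ellipse a b P.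
Proof.
  pose proof depth_pos as D. rewrite conic_normalize. unfold on_ellipse. split; intros E.
  - apply Rmult_integral in E as [E|E]; [lra|]. apply Rinv_neq_0_compat in E; [tauto|lra].
  - rewrite E. field. lra.
Qed.

Lemma contact_point P Q : side_tangent K P Q ->
  exists z, dot z z = 1 /\ dot z (normalize P) = 1 /\ dot z (normalize Q) = 1.
Proof.
  intros [T [[s [_ ET]] [OT Perp]]]. exists (normalize T).
  apply normalize_on_circle in OT. split; trivial.
  assert (X : dot (normalize T) (sub (normalize Q) (normalize P)) = 0).
  { transitivity (((fst T - fst (center K)) * (fst Q - fst P) +
      (snd T - snd (center K)) * (snd Q - snd P)) / radius K ^ 2).
    - unfold normalize. coords. field. lra.
    - rewrite Perp. field. lra. }
  assert (Y : normalize T = add (normalize P) (scale s (sub (normalize Q) (normalize P)))).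
  { rewrite ET. unfold normalize. apply injective_projections; coords; field; lra. }
  split.
  - transitivity (dot (normalize T) (normalize T) - s * dot (normalize T) (sub (normalize Q) (normalize P))).
    + rewrite Y at 3. coords; ring.
    + rewrite X, OT. ring.
  - transitivity (dot (normalize T) (normalize T) + (1 - s) * dot (normalize T) (sub (normalize Q) (normalize P))).
    + rewrite Y at 3. coords; ring.
    + rewrite X, OT. ring.
Qed.

Lemma collinear_normalize P Q T :
  collinear P Q T <-> cross (sub (normalize Q) (normalize P)) (sub (normalize T) (normalize P)) = 0.
Proof.
  unfold collinear.
  replace (cross (sub (normalize Q) (normalize P)) (sub (normalize T) (normalize P))) with
   (((fst Q - fst P) * (snd T - snd P) - (snd Q - snd P) * (fst T - fst P)) / radius K ^ 2)
   by (unfold normalize; coords; field; lra).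
  split; intros E.
  - rewrite E. field. lra.
  - apply Rmult_integral in E as [E|E]; trivial.
    apply Rinv_neq_0_compat in E; [tauto|]. apply pow_nonzero. lra.
Qed.

Lemma common_tangent_collinear z P Q T :
  dot z z = 1 -> dot z (normalize P) = 1 -> dot z (normalize Q) = 1 -> dot z (normalize T) = 1 -> collinear P Q T.
Proof.
  intros U I1 I2 I3. apply collinear_normalize.
  destruct (Req_dec (cross (sub (normalize Q) (normalize P)) (sub (normalize T) (normalize P))) 0) as [|N]; trivial. exfalso.
  assert (Z : z = (0, 0)).
  { apply (dot_zero_basis _ _ _) with (3 := N).
    - transitivity (dot z (normalize Q) - dot z (normalize P)); [coords; ring|lra].
    - transitivity (dot z (normalize T) - dot z (normalize P)); [coords; ring|lra]. }
  rewrite Z in U. coords. lra.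
Qed.

Lemma poncelet_tangent_triangle P Q T :
  poncelet_triangle a b K P Q T -> exists z1 z2 z3, tangent z1 z2 z3 (normalize P) (normalize Q) (normalize T).
Proof.
  intros [NC [EP [EQ [ET [S3 [S1 S2]]]]]].
  apply contact_point in S1 as [z1 [U1 [I12 I13]]].
  apply contact_point in S2 as [z2 [U2 [I23 I21]]].
  apply contact_point in S3 as [z3 [U3 [I31 I32]]].
  exists z1, z2, z3. constructor; trivial; try now apply conic_normalize_iff.
  - intros ->. apply NC. now apply (common_tangent_collinear z2).
  - intros ->. apply NC. now apply (common_tangent_collinear z3).
  - intros ->. apply NC. now apply (common_tangent_collinear z1).
Qed.

(** The contact point lies between [P] and [Q] because it is inside the ellipse and
    the equation of the ellipse is strictly convex along the side. *)
Lemma segment_contact z P Q :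
  dot z z = 1 -> dot z (normalize P) = 1 -> dot z (normalize Q) = 1 -> P <> Q ->
  on_ellipse a b P -> on_ellipse a b Q -> side_tangent K P Q.
Proof.
  intros U IP IQ N EP EQ.
  assert (N2 : 0 < dot (sub Q P) (sub Q P)) by (apply point_neq_sqdist; auto).
  assert (OT : on_circle K (denormalize z)) by now apply on_circle_denormalize.
  assert (Perp : dot (sub (denormalize z) (center K)) (sub Q P) = 0).
  { transitivity (radius K ^ 2 * (dot z (normalize Q) - dot z (normalize P))).
    - unfold denormalize, normalize. coords. field. lra.
    - rewrite IP, IQ. ring. }
  set (s := dot (sub (denormalize z) P) (sub Q P) / dot (sub Q P) (sub Q P)).
  assert (PP : dot (sub (denormalize z) (center K)) (sub (denormalize z) P) = 0).
  { transitivity (radius K ^ 2 * (dot z z - dot z (normalize P))).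
    - unfold denormalize, normalize. coords. field. lra.
    - rewrite IP, U. ring. }
  assert (Ez : denormalize z = add P (scale s (sub Q P))).
  { assert (Z : sub (sub (denormalize z) P) (scale s (sub Q P)) = (0, 0)).
    { apply (dot_zero_basis _ (sub (denormalize z) (center K)) (sub Q P)).
      - transitivity (dot (sub (denormalize z) (center K)) (sub (denormalize z) P) - s * dot (sub (denormalize z) (center K)) (sub Q P)).
        + generalize (denormalize z) s. intros. coords. ring.
        + rewrite PP, Perp. ring.
      - transitivity (dot (sub (denormalize z) P) (sub Q P) - s * dot (sub Q P) (sub Q P)).
        + generalize (denormalize z) s. intros. coords. ring.
        + unfold s. field. lra.
      - intros C.
        assert (X : dot (sub (denormalize z) (center K)) (sub (denormalize z) (center K)) * dot (sub Q P) (sub Q P) = 0).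
        { transitivity (cross (sub (denormalize z) (center K)) (sub Q P) ^ 2 + dot (sub (denormalize z) (center K)) (sub Q P) ^ 2).
          - coords. ring.
          - rewrite C, Perp. ring. }
        assert (Y : dot (sub (denormalize z) (center K)) (sub (denormalize z) (center K)) = radius K ^ 2 * dot z z)
          by (unfold denormalize; coords; ring).
        rewrite Y, U in X. apply Rmult_integral in X as [X|X]; [nra|lra]. }
    clear - Z. clearbody s. generalize dependent (denormalize z). intros p Z. coords. injection Z. intros.
    apply injective_projections; cbn [fst snd]; lra. }
  exists (denormalize z). split; [|split; [trivial|exact Perp]].
  exists s. split; [|exact Ez].
  pose proof (K_inside _ OT) as I. unfold in_ellipse, on_ellipse in *. rewrite Ez in I.
  assert (X : ellipse_form a b (add P (scale s (sub Q P))) =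
     (1 - s) * ellipse_form a b P + s * ellipse_form a b Q - s * (1 - s) * ellipse_form a b (sub Q P)).
  { clearbody s. unfold ellipse_form. coords. field. lra. }
  rewrite X, EP, EQ in I.
  assert (Y : 0 <= ellipse_form a b (sub Q P)).
  { unfold ellipse_form. apply Rplus_le_le_0_compat; apply Rmult_le_pos;
    try apply pow2_ge_0; left; apply Rinv_0_lt_compat, pow_lt; lra. }
  set (q := ellipse_form a b (sub Q P)) in *. clearbody s q.
  assert (Sp : 0 < s * (1 - s)).
  { destruct (Rlt_or_le 0 (s * (1 - s))) as [|Sn]; trivial. nra. }
  split; nra.
Qed.

Lemma tangent_noncollinear z1 z2 z3 P Q T :
  tangent z1 z2 z3 (normalize P) (normalize Q) (normalize T) -> ~ collinear P Q T.
Proof.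
  intros Ht C%collinear_normalize. open_triangle Ht.
  assert (X : forall W, dot z1 W = 1 -> dot z2 W = 1 -> dot z3 W = 1 -> False).
  { intros W J1 J2 J3.
    assert (Z : W = (0, 0)).
    { apply (dot_zero_basis _ (sub z2 z3) (sub z1 z3)).
      - transitivity (dot z2 W - dot z3 W); [coords; ring|lra].
      - transitivity (dot z1 W - dot z3 W); [coords; ring|lra].
      - now apply unit_points_noncollinear. }
    subst W. coords. lra. }
  apply (X (normalize T)); trivial.
  assert (N : normalize P <> normalize Q).
  { intros E. apply (X (normalize P)); trivial. now rewrite E. }
  apply not_eq_sym, point_neq_sqdist in N.
  set (d := sub (normalize Q) (normalize P)) in *. set (e := sub (normalize T) (normalize P)) in *.
  assert (Y : dot d d * dot z3 e = dot e d * dot z3 d + cross d e * dot z3 (- snd d, fst d)).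
  { generalize d e. intros. coords. ring. }
  assert (Zd : dot z3 d = 0).
  { transitivity (dot z3 (normalize Q) - dot z3 (normalize P)); [unfold d; coords; ring|lra]. }
  assert (Ze : dot z3 e = dot z3 (normalize T) - dot z3 (normalize P)) by (unfold e; coords; ring).
  rewrite C, Zd in Y. apply (Rmult_eq_reg_l (dot d d)); [|lra].
  assert (Y' : dot d d * dot z3 e = 0) by lra.
  apply Rmult_integral in Y' as [Y'|Y']; [lra|].
  replace (dot z3 (normalize T)) with 1 by lra. ring.
Qed.

Lemma tangent_poncelet z1 z2 z3 P Q T :
  tangent z1 z2 z3 (normalize P) (normalize Q) (normalize T) -> poncelet_triangle a b K P Q T.
Proof.
  intros Ht. pose proof (tangent_noncollinear _ _ _ _ _ _ Ht) as NC. open_triangle Ht.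
  apply conic_normalize_iff in on_1, on_2, on_3.
  assert (P <> Q) by (intros ->; apply NC; unfold collinear; ring).
  assert (Q <> T) by (intros ->; apply NC; unfold collinear; ring).
  assert (T <> P) by (intros ->; apply NC; unfold collinear; ring).
  split; [trivial|]. split; [trivial|]. split; [trivial|]. split; [trivial|].
  split; [|split].
  - now apply (segment_contact z3).
  - now apply (segment_contact z1).
  - now apply (segment_contact z2).
Qed.

(** A single triangle supplies Cayley's condition; the rest follows from [b < a] and the
    inclusion of the circle in the ellipse. *)
Lemma normal_form_of_triangle P Q T :
  poncelet_triangle a b K P Q T -> poncelet_normal_form coef_x coef_y coef_lin.
Proof.
  intros Ht. apply poncelet_tangent_triangle in Ht as [z1 [z2 [z3 Ht]]].
  pose proof depth_pos as D. destruct depth_bounds as [Da Db].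
  assert (ra : 0 < radius K ^ 2) by (apply pow_lt; lra).
  assert (pa : 0 < a ^ 2) by (apply pow_lt; lra).
  assert (pb : 0 < b ^ 2) by (apply pow_lt; lra).
  constructor.
  - unfold coef_x. apply Rdiv_lt_0_compat; trivial. now apply Rmult_lt_0_compat.
  - unfold coef_x, coef_y, Rdiv. apply Rmult_lt_compat_l; trivial.
    apply Rinv_lt_contravar.
    + apply Rmult_lt_0_compat; apply Rmult_lt_0_compat; trivial.
    + apply Rmult_lt_compat_r; trivial. nra.
  - unfold coef_y. apply (Rmult_lt_reg_r depth); trivial.
    replace (radius K ^ 2 / (b ^ 2 * depth) * depth) with (radius K ^ 2 / b ^ 2) by (field; lra).
    lra.
  - intros z U. rewrite <- (normalize_denormalize z), conic_normalize.
    apply on_circle_denormalize, K_inside in U. unfold in_ellipse in U.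
    apply Ropp_lt_cancel. rewrite Ropp_0.
    replace (- ((ellipse_form a b (denormalize z) - 1) / depth)) with ((1 - ellipse_form a b (denormalize z)) / depth) by (field; lra).
    apply Rdiv_lt_0_compat; lra.
  - eapply cayley. exact Ht.
Qed.

Context (H : poncelet_normal_form coef_x coef_y coef_lin).

Notation sum_of P Q T := (contact_sum coef_x coef_y coef_lin (normalize P) (normalize Q) (normalize T)).
Notation v := (coef_y - coef_x).

Lemma poncelet_tangent_contacts P Q T : poncelet_triangle a b K P Q T ->
  tangent (opposite_contact coef_x coef_y coef_lin (normalize P)) (opposite_contact coef_x coef_y coef_lin (normalize Q))
          (opposite_contact coef_x coef_y coef_lin (normalize T)) (normalize P) (normalize Q) (normalize T).
Proof.
  intros Ht. apply poncelet_tangent_triangle in Ht as [z1 [z2 [z3 Ht]]].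
  eapply tangent_opposite_contacts; eassumption.
Qed.

Lemma contact_sum_on_circle P Q T : poncelet_triangle a b K P Q T ->
  dot (sub (sum_of P Q T) coef_lin) (sub (sum_of P Q T) coef_lin) = v ^ 2.
Proof.
  intros Ht. apply poncelet_tangent_contacts in Ht. now apply sum_on_circle in Ht.
Qed.

(** * Circumcircle and radical axis *)

(** The circumradius is [2 / (1 - |s| ^ 2)], in units of the inradius, for the
    contact sum [s]; see [apex_circle]. *)
Definition circumcircle_of_sum (s : point) : circle :=
  Circle (denormalize (scale (- (2 / (1 - dot s s))) s)) (radius K * (2 / (1 - dot s s))).

Lemma circumcircle_of_sum_through P Q T : poncelet_triangle a b K P Q T ->
  is_circumcircle (circumcircle_of_sum (sum_of P Q T)) P Q T.
Proof.
  intros Ht. pose proof (contact_sum_on_circle P Q T Ht) as S. apply circle_in_disk in S; trivial.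
  apply poncelet_tangent_contacts in Ht. set (s := sum_of P Q T) in *.
  assert (X : forall V, (1 - dot s s) * dot (normalize V) (normalize V) + 4 * dot (normalize V) s = 4 -> on_circle (circumcircle_of_sum s) V).
  { clear - S r_pos. clearbody s. intros V E. unfold on_circle, circumcircle_of_sum. cbn [center radius].
    assert (0 < 2 / (1 - dot s s)) by (apply Rdiv_lt_0_compat; lra).
    apply nonneg_eq_iff_sqr; [apply dist_nonneg|nra|]. rewrite dist_sqr.
    rewrite <- (denormalize_normalize V) at 1 2. set (W := normalize V) in *. clearbody W.
    transitivity (radius K ^ 2 * (dot W W + 4 / (1 - dot s s) * dot W s + (2 / (1 - dot s s)) ^ 2 * dot s s)).
    - replace (4 / (1 - dot s s)) with (2 * (2 / (1 - dot s s))) by (field; lra).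
      generalize (2 / (1 - dot s s)). intros. unfold denormalize. coords. ring.
    - replace (dot W s) with (1 - (1 - dot s s) * dot W W / 4) by lra. field. lra. }
  open_triangle Ht. repeat split; apply X.
  - replace s with (sum3 (opposite_contact coef_x coef_y coef_lin (normalize Q)) (opposite_contact coef_x coef_y coef_lin (normalize T))
      (opposite_contact coef_x coef_y coef_lin (normalize P))) by (unfold s, contact_sum; coords; f_equal; ring).
    destruct (apex _ _ (normalize P) unit_2 unit_3) as [D E]; trivial.
    apply (apex_circle _ _ _ _ unit_2 unit_3 unit_1 D E).
  - replace s with (sum3 (opposite_contact coef_x coef_y coef_lin (normalize T)) (opposite_contact coef_x coef_y coef_lin (normalize P))
      (opposite_contact coef_x coef_y coef_lin (normalize Q))) by (unfold s, contact_sum; coords; f_equal; ring).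
    destruct (apex _ _ (normalize Q) unit_3 unit_1) as [D E]; trivial.
    apply (apex_circle _ _ _ _ unit_3 unit_1 unit_2 D E).
  - destruct (apex _ _ (normalize T) unit_1 unit_2) as [D E]; trivial.
    apply (apex_circle _ _ _ _ unit_1 unit_2 unit_3 D E).
Qed.

Lemma circumcenter_unique (S S' : circle) P Q T :
  ~ collinear P Q T -> is_circumcircle S P Q T -> is_circumcircle S' P Q T ->
  center S = center S'.
Proof.
  intros NC [A1 [A2 A3]] [B1 [B2 B3]].
  assert (X : forall V, on_circle S V -> on_circle S' V ->
     dot (sub V (center S)) (sub V (center S)) - dot (sub V (center S')) (sub V (center S')) =
     radius S ^ 2 - radius S' ^ 2).
  { unfold on_circle. intros V <- <-. now rewrite !dist_sqr. }
  pose proof (X P A1 B1) as XP. pose proof (X Q A2 B2) as XQ. pose proof (X T A3 B3) as XT.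
  assert (Z : sub (center S) (center S') = (0, 0)).
  { apply (dot_zero_basis _ (sub Q P) (sub T P)); trivial.
    - clear - XP XQ. coords. lra.
    - clear - XP XT. coords. lra. }
  clear - Z. coords. injection Z. intros. apply injective_projections; lra.
Qed.

(** In normalized coordinates [w] the radical axis is [4 w s = 3 + |s| ^ 2].  On the
    circle of contact sums [|s| ^ 2 = 2 u s + v ^ 2 - |u| ^ 2], and the equation
    becomes [(w - u / 2) s = polar_const]: a polar with respect to a circle around
    [polar_focus], the point [w = u / 2]. *)
Definition polar_focus : point := add (center K) (scale (radius K / 2) coef_lin).
Definition polar_const : R := (3 + v ^ 2 - dot coef_lin coef_lin) / 4.

Lemma radical_axis_polar P Q T X : poncelet_triangle a b K P Q T ->
  (exists S, is_circumcircle S P Q T /\ radical_axis K S X) <->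
  dot (sum_of P Q T) (scale (/ radius K) (sub X polar_focus)) = polar_const.
Proof.
  intros Ht. pose proof (circumcircle_of_sum_through P Q T Ht) as C.
  pose proof (contact_sum_on_circle P Q T Ht) as On. pose proof (circle_in_disk _ _ _ H _ On) as D.
  set (s := sum_of P Q T) in *. clearbody s.
  assert (E1 : (exists S, is_circumcircle S P Q T /\ radical_axis K S X) <-> radical_axis K (circumcircle_of_sum s) X).
  { split; [|now exists (circumcircle_of_sum s)]. intros [S [CS RS]].
    pose proof (circumcenter_unique S (circumcircle_of_sum s) P Q T (proj1 Ht) CS C) as Ec.
    destruct CS as [C1 _], C as [C1' _]. unfold on_circle in *.
    unfold radical_axis, power in *. rewrite <- C1', <- Ec, C1. exact RS. }
  rewrite E1. unfold radical_axis, power. cbn [center radius circumcircle_of_sum].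
  rewrite !dist_sqr. rewrite <- (denormalize_normalize X). set (w := normalize X). clearbody w.
  assert (E2 : dot (sub (denormalize w) (center K)) (sub (denormalize w) (center K)) = radius K ^ 2 * dot w w)
    by (unfold denormalize; coords; ring).
  assert (E3 : dot (sub (denormalize w) (denormalize (scale (- (2 / (1 - dot s s))) s))) (sub (denormalize w) (denormalize (scale (- (2 / (1 - dot s s))) s)))
     - (radius K * (2 / (1 - dot s s))) ^ 2 = radius K ^ 2 * (dot w w + 4 / (1 - dot s s) * (dot w s - 1))).
  { transitivity (radius K ^ 2 * (dot w w + 2 * (2 / (1 - dot s s)) * dot w s - (2 / (1 - dot s s)) ^ 2 * (1 - dot s s))).
    - generalize (2 / (1 - dot s s)) at 1 2 3 4 5. intros. unfold denormalize. coords. ring.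
    - field. lra. }
  rewrite E2, E3.
  assert (E4 : dot s (scale (/ radius K) (sub (denormalize w) polar_focus)) = dot w s - dot s coef_lin / 2).
  { unfold denormalize, polar_focus. coords. field. lra. }
  rewrite E4. unfold polar_const.
  assert (E5 : v ^ 2 = dot s s - 2 * dot s coef_lin + dot coef_lin coef_lin).
  { rewrite <- On. coords. ring. }
  rewrite E5. clear E1 E2 E3 E4 E5. generalize (dot w s) (dot s coef_lin) (dot w w).
  set (N := dot s s) in *. clearbody N. intros x y t.
  assert (R2 : 0 < radius K ^ 2) by (apply pow_lt; lra).
  split; intros E.
  - assert (E' : radius K ^ 2 * (1 + 4 / (1 - N) * (x - 1)) = 0) by lra.
    apply Rmult_integral in E' as [E'|E']; [lra|].
    assert (E'' : (1 - N) + 4 * (x - 1) = 0).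
    { transitivity ((1 - N) * (1 + 4 / (1 - N) * (x - 1))); [field; lra|]. rewrite E'. ring. }
    lra.
  - replace x with (1 - (1 - N) / 4) by lra. field. lra.
Qed.

(** * An explicit parametrization of the family *)

(** The vertex moves by the eccentric angle, and the other two vertices are explicit
    in it: each lies on one of the tangents from the first and on the opposite
    side. *)
Definition ellipse_point (t : R) : point := (a * cos t, b * sin t).

Lemma on_ellipse_ellipse_point t : on_ellipse a b (ellipse_point t).
Proof.
  unfold on_ellipse, ellipse_form, ellipse_point. cbn [fst snd].
  transitivity (Rsqr (sin t) + Rsqr (cos t)); [unfold Rsqr; field; lra|apply sin2_cos2].
Qed.

Lemma ellipse_point_onto P : on_ellipse a b P -> exists t, P = ellipse_point t.
Proof.
  intros E. destruct (unit_angle (fst P / a, snd P / b)) as [t Et].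
  - rewrite <- E. unfold ellipse_form. coords. field. lra.
  - exists t. unfold ellipse_point. injection Et. intros <- <-. apply injective_projections; cbn; field; lra.
Qed.

Definition apex1 (t : R) : point := normalize (ellipse_point t).
Definition left_contact (t : R) : point := tangent_contact (tangent_length (apex1 t)) (apex1 t).
Definition right_contact (t : R) : point := tangent_contact (- tangent_length (apex1 t)) (apex1 t).
Definition third_contact (t : R) : point := opposite_contact coef_x coef_y coef_lin (apex1 t).
Definition apex2 (t : R) : point := vertex (right_contact t) (third_contact t).
Definition apex3 (t : R) : point := vertex (third_contact t) (left_contact t).

Lemma family_tangent t :
  tangent (third_contact t) (left_contact t) (right_contact t) (apex1 t) (apex2 t) (apex3 t).
Proof. apply triangle_at_apex; trivial. apply conic_normalize_iff, on_ellipse_ellipse_point. Qed.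

Lemma family_poncelet t :
  poncelet_triangle a b K (ellipse_point t) (denormalize (apex2 t)) (denormalize (apex3 t)).
Proof.
  apply tangent_poncelet with (third_contact t) (left_contact t) (right_contact t). rewrite !normalize_denormalize. apply family_tangent.
Qed.

(** Both tangents from the first vertex and the third contact point are determined by
    that vertex; only the order of the two tangents is not. *)
Lemma family_covers P Q T : poncelet_triangle a b K P Q T ->
  exists t, Permutation [P; Q; T] [ellipse_point t; denormalize (apex2 t); denormalize (apex3 t)].
Proof.
  intros Ht. destruct (ellipse_point_onto P) as [t Et]; [apply Ht|]. exists t.
  apply poncelet_tangent_contacts in Ht. rewrite Et in *. clear Et P.
  set (z2 := opposite_contact _ _ _ (normalize Q)) in *. set (z3 := opposite_contact _ _ _ (normalize T)) in *. clearbody z2 z3.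
  pose proof (conic_outside _ _ _ H (normalize (ellipse_point t)) (on1 _ _ _ _ _ _ _ _ _ Ht)) as O.
  fold (apex1 t) in Ht, O. fold (third_contact t) in Ht. open_triangle Ht.
  assert (W2 : normalize Q = vertex z3 (third_contact t)) by now apply vertex_unique.
  assert (W3 : normalize T = vertex (third_contact t) z2) by now apply vertex_unique.
  rewrite <- (denormalize_normalize Q), <- (denormalize_normalize T), W2, W3.
  assert (V : forall z w, vertex z w = vertex w z).
  { intros z w. unfold vertex, dot. f_equal; [f_equal; ring|]. coords. f_equal; ring. }
  apply perm_skip.
  destruct (tangent_contacts z2 (apex1 t)) as [E2|E2], (tangent_contacts z3 (apex1 t)) as [E3|E3];
    trivial; fold (left_contact t) in E2, E3; fold (right_contact t) in E2, E3.
  - congruence.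
  - unfold apex2, apex3. rewrite E2, E3. apply Permutation_refl.
  - unfold apex2, apex3. rewrite E2, E3, (V (left_contact t)), (V (third_contact t) (right_contact t)). apply perm_swap.
  - congruence.
Qed.

Lemma normalize_differentiable (P : R -> point) t :
  ex_derive_point P t -> ex_derive_point (fun s => normalize (P s)) t.
Proof. intros D. unfold normalize, ex_derive_point in *. split; coords; scalarize P; auto_derive; tauto. Qed.

Lemma denormalize_differentiable (P : R -> point) t :
  ex_derive_point P t -> ex_derive_point (fun s => denormalize (P s)) t.
Proof. intros D. unfold denormalize, ex_derive_point in *. split; coords; scalarize P; auto_derive; tauto. Qed.

Lemma velocity_normalize (P : R -> point) t :
  ex_derive_point P t -> velocity (fun s => normalize (P s)) t = scale (/ radius K) (velocity P t).
Proof.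
  intros D. unfold ex_derive_point in *.
  apply velocity_unique; unfold normalize, velocity; coords; scalarize P; derive_ring.
Qed.

Lemma family_differentiable t :
  ex_derive_point ellipse_point t /\ ex_derive_point (fun s => denormalize (apex2 s)) t /\
  ex_derive_point (fun s => denormalize (apex3 s)) t.
Proof.
  assert (D1 : ex_derive_point ellipse_point t) by (unfold ellipse_point; split; cbn; auto_derive; trivial).
  assert (D : ex_derive_point apex1 t) by now apply (normalize_differentiable ellipse_point).
  pose proof (family_tangent t) as Ht. open_triangle Ht.
  pose proof (conic_outside _ _ _ H _ on_1) as O.
  assert (Dtau : ex_derive (fun s => tangent_length (apex1 s)) t) by now apply tangent_length_differentiable.
  assert (Dl : ex_derive_point left_contact t).
  { apply (tangent_contact_differentiable (fun s => tangent_length (apex1 s)) apex1); trivial. lra. }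
  assert (Dr : ex_derive_point right_contact t).
  { apply (tangent_contact_differentiable (fun s => - tangent_length (apex1 s)) apex1); trivial; [lra|].
    now apply (@ex_derive_opp R_AbsRing R_NormedModule). }
  assert (Dt : ex_derive_point third_contact t).
  { apply opposite_contact_differentiable; trivial. eapply Rgt_not_eq, opposite_denominator_pos; eassumption. }
  split; [trivial|split].
  - apply denormalize_differentiable. apply (vertex_differentiable right_contact third_contact); trivial.
    now apply (tangents_not_antipodal _ _ (apex2 t)).
  - apply denormalize_differentiable. apply (vertex_differentiable third_contact left_contact); trivial.
    now apply (tangents_not_antipodal _ _ (apex3 t)).
Qed.

Lemma velocity_ellipse_point t : velocity ellipse_point t <> (0, 0).
Proof.
  assert (E : velocity ellipse_point t = (- a * sin t, b * cos t)).
  { apply velocity_unique; unfold ellipse_point; cbn; auto_derive; trivial; ring. }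
  rewrite E. intros [= E1 E2]. pose proof (sin2_cos2 t) as S.
  assert (sin t = 0). { apply (Rmult_eq_reg_l (- a)); lra. }
  assert (cos t = 0). { apply (Rmult_eq_reg_l b); lra. }
  rewrite H0, H1 in S. unfold Rsqr in S. lra.
Qed.

Lemma family_parametrization :
  poncelet_parametrization a b K ellipse_point (fun t => denormalize (apex2 t)) (fun t => denormalize (apex3 t)).
Proof.
  split; [exact family_poncelet|]. split; [exact family_covers|].
  split; [exact family_differentiable|]. intros t. left. apply velocity_ellipse_point.
Qed.

(** * The envelope for an arbitrary parametrization *)

Section Parametrized.
Context (P Q T : R -> point) (Hp : poncelet_parametrization a b K P Q T).

Definition track (t : R) : point := sum_of (P t) (Q t) (T t).

Lemma track_differentiable t : ex_derive_point track t.
Proof.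
  destruct Hp as [Ht [_ [D _]]]. destruct (D t) as [D1 [D2 D3]].
  apply (contact_sum_differentiable _ _ _ H (fun s => normalize (P s)) (fun s => normalize (Q s)) (fun s => normalize (T s)));
    try now apply normalize_differentiable.
  apply poncelet_tangent_contacts, Ht.
Qed.

Lemma track_on t : dot (sub (track t) coef_lin) (sub (track t) coef_lin) = v ^ 2.
Proof. destruct Hp as [Ht _]. apply contact_sum_on_circle, Ht. Qed.

Lemma track_regular t : velocity track t <> (0, 0).
Proof.
  destruct Hp as [Ht [_ [D N]]]. destruct (D t) as [D1 [D2 D3]]. intros V.
  destruct (contact_sum_regular _ _ _ H (fun s => normalize (P s)) (fun s => normalize (Q s)) (fun s => normalize (T s)) t)
    as [V1 [V2 V3]]; trivial; try now apply normalize_differentiable.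
  { intros s. apply poncelet_tangent_contacts, Ht. }
  rewrite velocity_normalize in V1, V2, V3 by trivial.
  assert (X : forall p, scale (/ radius K) p = (0, 0) -> p = (0, 0)).
  { intros p E. transitivity (scale (radius K) (scale (/ radius K) p)).
    - apply injective_projections; coords; field; lra.
    - rewrite E. coords. f_equal; ring. }
  apply X in V1, V2, V3. destruct (N t) as [|[|]]; tauto.
Qed.

Lemma sum_of_permutation P1 Q1 T1 P2 Q2 T2 :
  Permutation [P1; Q1; T1] [P2; Q2; T2] -> sum_of P1 Q1 T1 = sum_of P2 Q2 T2.
Proof.
  intros E.
  set (g := fun V : point => opposite_contact coef_x coef_y coef_lin (normalize V)).
  assert (X : forall V1 V2 V3, sum_of V1 V2 V3 = fold_right add (0, 0) (map g [V1; V2; V3])).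
  { intros. unfold contact_sum. fold (g V1) (g V2) (g V3). cbn [map fold_right].
    generalize (g V1) (g V2) (g V3). intros. coords. f_equal; ring. }
  rewrite !X. apply (Permutation_map g) in E.
  induction E; cbn [fold_right]; [trivial|congruence| |congruence].
  coords. f_equal; ring.
Qed.

(** Every point of the circle is the contact sum of some triangle, every triangle
    occurs in the family up to order, and the sum ignores the order. *)
Lemma track_onto s : dot (sub s coef_lin) (sub s coef_lin) = v ^ 2 -> exists t, track t = s.
Proof.
  intros E. destruct Hp as [_ [Cov _]].
  destruct (triangle_with_sum _ _ _ H s E) as [z1 [z2 [z3 [W1 [W2 [W3 [Ht S]]]]]]].
  rewrite <- (normalize_denormalize W1), <- (normalize_denormalize W2), <- (normalize_denormalize W3) in Ht.
  pose proof (contact_sum_eq _ _ _ H _ _ _ _ _ _ Ht) as S'. rewrite S in S'.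
  apply tangent_poncelet in Ht. apply Cov in Ht as [t Ht]. exists t.
  rewrite <- S'. symmetry. now apply sum_of_permutation.
Qed.

Lemma polar_const_pos : 0 < polar_const.
Proof.
  pose proof (v_bounds _ _ _ H). unfold polar_const.
  pose proof (coef_lin_small _ _ _ H). pose proof (AB_lt_1 _ _ _ H).
  pose proof (A_pos _ _ _ H). pose proof (A_lt_B _ _ _ H). nra.
Qed.

Lemma envelope_equation (l m n : R -> R) :
  radical_axis_family a b K P Q T l m n ->
  forall X, envelope l m n X <->
    v ^ 2 * dot (sub X polar_focus) (sub X polar_focus) =
    (radius K * polar_const - dot coef_lin (sub X polar_focus)) ^ 2.
Proof.
  intros [_ [D E]] X. pose proof polar_const_pos. pose proof (v_bounds _ _ _ H).
  rewrite (envelope_of_polars l m n track polar_focus (radius K) polar_const); trivial; try lra.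
  2: apply track_differentiable.
  2: { intros t V. rewrite E. apply radical_axis_polar, Hp. }
  rewrite (envelope_polar_circle coef_lin v polar_const track); try lra.
  2: apply track_differentiable.
  2: apply track_on.
  2: apply track_regular.
  2: apply track_onto.
  set (Y := sub X polar_focus).
  replace (dot (scale (/ radius K) Y) (scale (/ radius K) Y)) with (dot Y Y / radius K ^ 2)
    by (coords; field; lra).
  replace (dot coef_lin (scale (/ radius K) Y)) with (dot coef_lin Y / radius K)
    by (coords; field; lra).
  split; intros Z.
  - transitivity (radius K ^ 2 * (v ^ 2 * (dot Y Y / radius K ^ 2))); [field; lra|].
    rewrite Z. field. lra.
  - transitivity ((v ^ 2 * dot Y Y) / radius K ^ 2); [field; lra|]. rewrite Z. field. lra.
Qed.

End Parametrized.

(** * The locus of circumcenters *)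

Lemma circumcenter_locus_equation X :
  circumcenter_locus a b K X <->
  (1 - coef_x - coef_y) ^ 2 * (dot (normalize X) (normalize X) + 1) = (coef_x + coef_y - dot coef_lin (normalize X)) ^ 2.
Proof.
  split.
  - intros [P [Q [T [S [Ht [CS <-]]]]]].
    rewrite (circumcenter_unique S (circumcircle_of_sum (sum_of P Q T)) P Q T); trivial;
      [|apply Ht|now apply circumcircle_of_sum_through].
    cbn [circumcircle_of_sum center]. rewrite normalize_denormalize.
    apply (center_equation _ _ _ H). now apply contact_sum_on_circle.
  - intros E. apply (center_equation_inv _ _ _ H) in E as [s [Es Eo]].
    destruct (track_onto _ _ _ family_parametrization s Es) as [t <-].
    exists (ellipse_point t), (denormalize (apex2 t)), (denormalize (apex3 t)), (circumcircle_of_sum (track ellipse_point (fun t => denormalize (apex2 t)) (fun t => denormalize (apex3 t)) t)).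
    split; [apply family_poncelet|]. split.
    + apply circumcircle_of_sum_through, family_poncelet.
    + cbn [circumcircle_of_sum center]. rewrite <- Eo. apply denormalize_normalize.
Qed.

Lemma focus3_eq : focus3 a b K = add (center K) (scale (- b ^ 2) normal_dir).
Proof. unfold focus3, normal_dir. apply injective_projections; coords; field; lra. Qed.

Lemma focus3'_eq : focus3' a b K = add (center K) (scale (- a ^ 2) normal_dir).
Proof. unfold focus3', normal_dir. apply injective_projections; coords; field; lra. Qed.

Lemma polar_focus_eq : polar_focus = add (center K) (scale (radius K ^ 2 / depth) normal_dir).
Proof.
  pose proof depth_pos. unfold polar_focus, coef_lin.
  apply injective_projections; coords; field; lra.
Qed.

(** In normalized coordinates the two foci are [- u / (2 B)] and [- u / (2 A)]. *)
Lemma circumcenter_locus_ellipse :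
  ellipse_with_foci (circumcenter_locus a b K) (focus3 a b K) (focus3' a b K).
Proof.
  pose proof depth_pos as Dp. pose proof (A_pos _ _ _ H) as Ap. pose proof (A_lt_B _ _ _ H) as AB.
  pose proof (AB_lt_1 _ _ _ H) as L.
  assert (N1 : normalize (focus3 a b K) = scale (- / (2 * coef_y)) coef_lin).
  { rewrite focus3_eq. unfold normalize, coef_y, coef_lin. apply injective_projections; coords; field; lra. }
  assert (N2 : normalize (focus3' a b K) = scale (- / (2 * coef_x)) coef_lin).
  { rewrite focus3'_eq. unfold normalize, coef_x, coef_lin. apply injective_projections; coords; field; lra. }
  assert (N3 : forall X Y, dot (sub X Y) (sub X Y) = radius K ^ 2 * dot (sub (normalize X) (normalize Y)) (sub (normalize X) (normalize Y))).
  { intros. unfold normalize. coords. field. lra. }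
  set (s := (1 - coef_x - coef_y) * (coef_y - coef_x) / (4 * coef_x * coef_y)) in *.
  assert (sp : 0 < s) by (unfold s; apply Rdiv_lt_0_compat; nra).
  apply ellipse_of_equation with (s := radius K * s).
  - apply Rsqr_incrst_0; [|apply dist_nonneg|nra].
    rewrite !Rsqr_pow2, dist_sqr, (N3 (focus3 a b K) (focus3' a b K)), N1, N2.
    replace ((2 * (radius K * s)) ^ 2) with (radius K ^ 2 * (2 * s) ^ 2) by ring.
    apply Rmult_lt_compat_l; [apply pow_lt; lra|].
    replace (dot _ _) with (((coef_y - coef_x) / (2 * coef_x * coef_y)) ^ 2 * dot coef_lin coef_lin).
    + replace ((2 * s) ^ 2) with (((coef_y - coef_x) / (2 * coef_x * coef_y)) ^ 2 * (1 - coef_x - coef_y) ^ 2)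
        by (unfold s; field; lra).
      apply Rmult_lt_compat_l; [|now apply coef_lin_small].
      apply pow_lt, Rdiv_lt_0_compat; nra.
    + generalize coef_lin. intros. coords. field. lra.
  - intros X. rewrite circumcenter_locus_equation, center_equation_foci by trivial.
    unfold central_equation.
    rewrite (N3 X (focus3 a b K)), (N3 X (focus3' a b K)), N1, N2. fold s.
    set (d1 := dot _ _). set (d2 := dot _ _).
    assert (R2 : 0 < radius K ^ 4) by (apply pow_lt; lra).
    split; intros E.
    + transitivity (radius K ^ 4 * (16 * s ^ 2 * d1)); [ring|]. rewrite E. ring.
    + apply (Rmult_eq_reg_l (radius K ^ 4)); [|lra].
      transitivity (16 * (radius K * s) ^ 2 * (radius K ^ 2 * d1)); [ring|]. rewrite E. ring.
Qed.

(** * Type and axis of the envelope *)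

(** With [y = r ^ 2 / depth], [v = y mm], [coef_x + coef_y = y hh] and
    [|u| ^ 2 = y g], Cayley's condition becomes a quadratic equation for [y],
    and [g - y mm ^ 2], a positive multiple of the left-hand side, satisfies
    [(g - y mm ^ 2) (2 hh - mm ^ 2 y) = 2 hh g - mm ^ 2].  The right-hand side is a
    positive multiple of the ellipse form minus 1, and the second factor is
    positive because [v = y mm < 1] and [mm < hh]. *)
Lemma eccentricity_sign :
  exists c, 0 < c /\ dot coef_lin coef_lin - v ^ 2 = c * (ellipse_form (a_tri a b) (b_tri a b) (center K) - 1).
Proof.
  pose proof depth_pos as Dp. pose proof (v_bounds _ _ _ H) as V.
  pose proof (cayley_eq _ _ _ H) as C.
  set (p := fst (center K)) in *. set (q := snd (center K)) in *.
  set (y := radius K ^ 2 / depth).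
  set (mm := / b ^ 2 - / a ^ 2). set (hh := / a ^ 2 + / b ^ 2).
  set (g := 4 * (p ^ 2 / a ^ 4 + q ^ 2 / b ^ 4) / depth).
  assert (yp : 0 < y) by (apply Rdiv_lt_0_compat; trivial; apply pow_lt; lra).
  assert (U : dot coef_lin coef_lin = y * g).
  { unfold coef_lin, normal_dir, y, g, p, q. coords. field. lra. }
  assert (Vy : v = y * mm) by (unfold coef_x, coef_y, y, mm; field; lra).
  assert (Sy : coef_x + coef_y = y * hh) by (unfold coef_x, coef_y, y, hh; field; lra).
  rewrite U, Vy, Sy in C.
  assert (ia : 0 < / a ^ 2) by (apply Rinv_0_lt_compat, pow_lt; lra).
  assert (ib : / a ^ 2 < / b ^ 2).
  { apply Rinv_lt_contravar; [apply Rmult_lt_0_compat; apply pow_lt; lra|nra]. }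
  assert (mp : 0 < mm) by (unfold mm; lra).
  assert (mh : mm < hh) by (unfold mm, hh; lra).
  assert (N : 0 < 2 * hh - mm ^ 2 * y) by (rewrite Vy in V; nra).
  (* Cayley's relation, with the terms in [y] factored *)
  assert (Id : (g - y * mm ^ 2) * (2 * hh - mm ^ 2 * y) = 2 * hh * g - mm ^ 2) by nra.
  assert (F : 2 * hh * g - mm ^ 2 =
     mm ^ 2 / depth * (ellipse_form (a_tri a b) (b_tri a b) (center K) - 1)).
  { assert (F' : (2 * hh * g - mm ^ 2) * depth =
       mm ^ 2 * (ellipse_form (a_tri a b) (b_tri a b) (center K) - 1)).
    { transitivity (8 * hh * (p ^ 2 / a ^ 4 + q ^ 2 / b ^ 4) - mm ^ 2 * depth).
      - unfold g. field. lra.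
      - unfold depth, ellipse_form, hh, mm, a_tri, b_tri. fold p q. field.
        repeat split; nra. }
    apply (Rmult_eq_reg_r depth); [|lra]. rewrite F'. field. lra. }
  exists (y * (mm ^ 2 / depth) / (2 * hh - mm ^ 2 * y)). split.
  - apply Rdiv_lt_0_compat; trivial. apply Rmult_lt_0_compat; trivial.
    apply Rdiv_lt_0_compat; trivial. now apply pow_lt.
  - rewrite U, Vy.
    transitivity (y * ((g - y * mm ^ 2) * (2 * hh - mm ^ 2 * y)) / (2 * hh - mm ^ 2 * y)); [field; lra|].
    rewrite Id, F. field. lra.
Qed.

(** A line through two points of [X + R d] contains all of it.  The form covers
    [d = 0], where the hypotheses give just the point [X]. *)
Lemma line_direction (L : point -> Prop) (X d : point) (s t : R) :
  is_line L -> s <> t -> L (add X (scale s d)) -> L (add X (scale t d)) ->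
  forall w, L (add X (scale w d)).
Proof.
  intros [p [q [c [_ E]]]] N L1 L2 w. rewrite E in *. coords.
  assert (Z : (s - t) * (p * fst d + q * snd d) = 0) by lra.
  apply Rmult_integral in Z as [Z|Z]; [lra|].
  replace (p * (fst X + w * fst d) + q * (snd X + w * snd d) + c) with
   ((p * (fst X + s * fst d) + q * (snd X + s * snd d) + c) + (w - s) * (p * fst d + q * snd d)) by ring.
  rewrite L1, Z. ring.
Qed.

(** The equation of [radical_axis_polar] cleared of denominators has coefficients
    that stay valid for an equilateral triangle, where the contact sum is 0. *)
Lemma radical_axis_family_exists :
  exists (P Q T : R -> point) (l m n : R -> R), radical_axis_family a b K P Q T l m n.
Proof.
  set (Q := fun t => denormalize (apex2 t)). set (T := fun t => denormalize (apex3 t)).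
  pose proof family_parametrization as Hp. fold Q T in Hp.
  set (s := track ellipse_point Q T).
  exists ellipse_point, Q, T, (fun t => fst (s t)), (fun t => snd (s t)),
    (fun t => - (dot (s t) polar_focus + radius K * polar_const)).
  split; [exact Hp|]. split.
  - intros t. pose proof (track_differentiable _ _ _ Hp t) as D. fold s in D. clearbody s.
    unfold ex_derive_point in D. coords. scalarize s.
    repeat split; auto_derive; tauto.
  - intros t X. rewrite radical_axis_polar by apply Hp.
    change (sum_of (ellipse_point t) (Q t) (T t)) with (s t).
    assert (E : fst (s t) * fst X + snd (s t) * snd X + - (dot (s t) polar_focus + radius K * polar_const)
      = radius K * (dot (s t) (scale (/ radius K) (sub X polar_focus)) - polar_const)).
    { generalize polar_focus. intros. coords. field. lra. }
    rewrite E. split; intros Z.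
    + apply Rmult_integral in Z as [Z|Z]; lra.
    + rewrite Z. ring.
Qed.

Section Envelope.
Context (P Q T : R -> point) (l m n : R -> R) (HF : radical_axis_family a b K P Q T l m n).

Let h := radius K * polar_const.

Lemma envelope_ellipse :
  dot coef_lin coef_lin < v ^ 2 ->
  ellipse_with_foci (envelope l m n) polar_focus (second_focus polar_focus coef_lin v h).
Proof.
  pose proof polar_const_pos. pose proof (v_bounds _ _ _ H).
  apply focus_directrix_ellipse; [lra|unfold h; nra|].
  apply (envelope_equation P Q T); trivial. apply HF.
Qed.

Lemma envelope_hyperbola :
  v ^ 2 < dot coef_lin coef_lin ->
  hyperbola_with_foci (envelope l m n) polar_focus (second_focus polar_focus coef_lin v h).
Proof.
  pose proof polar_const_pos. pose proof (v_bounds _ _ _ H).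
  apply focus_directrix_hyperbola; [lra|unfold h; nra|].
  apply (envelope_equation P Q T); trivial. apply HF.
Qed.

Lemma envelope_parabola :
  dot coef_lin coef_lin = v ^ 2 ->
  parabola_with_focus_foot (envelope l m n) polar_focus (add polar_focus (scale (h / v ^ 2) coef_lin)).
Proof.
  pose proof polar_const_pos. pose proof (v_bounds _ _ _ H).
  apply focus_directrix_parabola; [lra|unfold h; nra|].
  apply (envelope_equation P Q T); trivial. apply HF.
Qed.

(** The focus and the direction of the envelope's axis are both obtained from the
    center of the circle by multiples of [normal_dir], and so is the line through the
    foci of the circumcenter locus. *)
Lemma envelope_axis (L : point -> Prop) :
  is_line L -> L (focus3 a b K) -> L (focus3' a b K) -> conic_with_major_axis (envelope l m n) L.
Proof.
  intros HL L1 L2. split; [trivial|].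
  assert (Ln : forall w, L (add (center K) (scale w normal_dir))).
  { rewrite focus3_eq in L1. rewrite focus3'_eq in L2.
    apply (line_direction L (center K) normal_dir _ _ HL) with (2 := L1) (3 := L2). nra. }
  assert (Lf : forall w, L (add polar_focus (scale w coef_lin))).
  { intros w. rewrite polar_focus_eq. unfold coef_lin.
    replace (add (add (center K) (scale (radius K ^ 2 / depth) normal_dir)) (scale w (scale (2 * radius K / depth) normal_dir)))
      with (add (center K) (scale (radius K ^ 2 / depth + w * (2 * radius K / depth)) normal_dir)); trivial.
    coords. f_equal; ring. }
  assert (L0 : L polar_focus) by (rewrite polar_focus_eq; apply Ln).
  assert (L0' : L (second_focus polar_focus coef_lin v h)).
  { unfold second_focus. set (c := 2 * h / _).
    replace (sub polar_focus (scale c coef_lin)) with (add polar_focus (scale (- c) coef_lin)); trivial.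
    coords. f_equal; ring. }
  destruct (Rtotal_order (dot coef_lin coef_lin) (v ^ 2)) as [E|[E|E]].
  - exists polar_focus, (second_focus polar_focus coef_lin v h).
    split; [trivial|split; [trivial|left]]. now apply envelope_ellipse.
  - exists polar_focus, (add polar_focus (scale (h / v ^ 2) coef_lin)).
    split; [trivial|split; [trivial|right; right]]. now apply envelope_parabola.
  - exists polar_focus, (second_focus polar_focus coef_lin v h).
    split; [trivial|split; [trivial|right; left]]. now apply envelope_hyperbola.
Qed.

End Envelope.

End Original.

Theorem proposition6 :
  forall (a b : R) (K : circle),
    0 < b -> b < a ->
    0 < radius K ->
    (forall P : point, on_circle K P -> in_ellipse a b P) ->
    (exists A B C : point, poncelet_triangle a b K A B C) ->
    (exists (A B C : R -> point) (l m n : R -> R),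
       radical_axis_family a b K A B C l m n) /\
    (forall (A B C : R -> point) (l m n : R -> R),
       radical_axis_family a b K A B C l m n ->
       (forall L : point -> Prop,
          is_line L -> L (focus3 a b K) -> L (focus3' a b K) ->
          conic_with_major_axis (envelope l m n) L /\
          conic_with_major_axis (circumcenter_locus a b K) L) /\
       (in_ellipse (a_tri a b) (b_tri a b) (center K) ->
          is_ellipse (envelope l m n)) /\
       (out_ellipse (a_tri a b) (b_tri a b) (center K) ->
          is_hyperbola (envelope l m n))).
Proof.
  intros a b K b_pos b_lt_a r_pos K_inside [P [Q [T Ht]]].
  assert (H : poncelet_normal_form (coef_x a b K) (coef_y a b K) (coef_lin a b K))
    by (eapply normal_form_of_triangle; eassumption).
  split; [now apply radical_axis_family_exists|].
  intros A B C l m n HF.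
  destruct (eccentricity_sign a b K) as [c [c_pos Ec]]; trivial.
  split; [|split].
  - intros L HL L1 L2. split.
    + now apply (envelope_axis a b K) with A B C.
    + split; [trivial|]. exists (focus3 a b K), (focus3' a b K).
      split; [trivial|split; [trivial|left]]. now apply circumcenter_locus_ellipse.
  - unfold in_ellipse. intros I. do 2 eexists.
    apply (envelope_ellipse a b K) with A B C; trivial. nra.
  - unfold out_ellipse. intros I. do 2 eexists.
    apply (envelope_hyperbola a b K) with A B C; trivial. nra.
Qed.
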